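(* Let $(X_k)_{k\ge 1}$ be a sequence of independent centered real random variables on a probability space, let $(p(n))_{n\ge1}$ be an arbitrary sequence of non-negative integers, and let $\delta>0$. Suppose that every $X_k$ has a finite $(2+\delta)$-moment and that $$A_n'(\delta)=\frac{1}{(s_n')^{2+\delta}}\sum_{k=p(n)+1}^{n+p(n)}\mathbb{E}|X_k|^{2+\delta}\longrightarrow 0\quad\text{as } n\to+\infty .$$ Then $S_n'/s_n'$ converges in distribution to $\mathcal{N}(0,1)$ as $n\to+\infty$.
   Context: Notation: $S_n'=\sum_{k=p(n)+1}^{n+p(n)}X_k$, $\sigma_k^2=\mathbb{E}(X_k^2)$, $s_n'=\left(\sum_{k=p(n)+1}^{n+p(n)}\sigma_k^2\right)^{1/2}$, the latter being assumed positive so that the quotients make sense. $\mathcal N(0,1)$ is the standard normal law. *)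

(* Defs.v *)
From HB Require Import structures.
From mathcomp Require Import all_boot all_order all_algebra finmap.
From mathcomp Require Import all_classical all_reals all_analysis.
From mathcomp Require Import measurable_realfun.

Set Implicit Arguments.
Unset Strict Implicit.
Unset Printing Implicit Defensive.

Import Order.TTheory GRing.Theory Num.Theory.
Import numFieldNormedType.Exports.

Local Open Scope classical_set_scope.
Local Open Scope ring_scope.

Section probability_notions.
Context d (T : measurableType d) (R : realType) (P : probability T R).

Definition mutually_independent (I : choiceType) (D : set I) d'
    (T' : measurableType d') (X : I -> {RV P >-> T'}) : Prop :=
  forall (J : {fset I}) (B : I -> set T'),
    [set` J] `<=` D -> (forall i, measurable (B i)) ->
    P (\bigcap_(i in [set` J]) (X i @^-1` B i)) =
    (\prod_(i <- J) P (X i @^-1` B i))%E.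

(* [measurableTypeR R] is [R] with its Borel sigma-algebra, convertible to the
   canonical one; it is the domain of the library's laws on the real line. *)
Definition cvg_in_distribution (Y : nat -> {RV P >-> R})
    (mu : probability (measurableTypeR R) R) : Prop :=
  forall x : R, {for x, continuous (fun y : R => mu `]-oo, y]%classic)} ->
    cdf (Y n) x @[n --> \oo] --> mu `]-oo, x]%classic.

End probability_notions.

Arguments mutually_independent {d T R} P {I} D {d' T'} X.
Arguments cvg_in_distribution {d T R} P Y mu.

(* [X k] is only used for [1 <= k]: the [n]-th block consists of the indices
   p(n) + 1, ..., p(n) + n. Expectations are extended reals; [fine] recovers
   their real value only if they are finite, which for all those below follows
   from the finiteness of the (2 + delta)-moments. *)
Section moving_blocks.
Context d (T : measurableType d) (R : realType) (P : probability T R).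
Variables (X : nat -> {RV P >-> R}) (p : nat -> nat).

Definition block_sum (n : nat) (w : T) : R :=
  \sum_((p n).+1 <= k < (n + p n).+1) X k w.

Definition block_sd (n : nat) : R :=
  Num.sqrt (\sum_((p n).+1 <= k < (n + p n).+1)
    fine 'E_P[fun w => X k w ^+ 2]).

Definition lyapunov_ratio (delta : R) (n : nat) : R :=
  (block_sd n `^ (2 + delta))^-1 *
  \sum_((p n).+1 <= k < (n + p n).+1)
    fine 'E_P[fun w => `|X k w| `^ (2 + delta)].

Definition normalized_block_sum (n : nat) (w : T) : R :=
  block_sum n w / block_sd n.

Lemma measurable_normalized_block_sum n :
  measurable_fun [set: T] (normalized_block_sum n).
Proof.
apply: measurable_funM => //.
by apply: measurable_sum => k; exact: measurable_funP.
Qed.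

HB.instance Definition _ n := isMeasurableFun.Build _ _ _ _
  (normalized_block_sum n) (measurable_normalized_block_sum n).

End moving_blocks.

(* Main.v *)
Require Import Defs.
From HB Require Import structures.
From mathcomp Require Import all_boot all_order all_algebra finmap.
From mathcomp Require Import all_classical all_reals all_analysis.
From mathcomp Require Import measurable_realfun.
From mathcomp Require Import ring lra.

Set Implicit Arguments.
Unset Strict Implicit.
Unset Printing Implicit Defensive.

Import Order.TTheory GRing.Theory Num.Theory.
Import numFieldNormedType.Exports.

Local Open Scope classical_set_scope.
Local Open Scope ring_scope.

(** The proof is Lindeberg's replacement argument.  The terms of a block are
exchanged one at a time for centred Gaussian terms with the same variances, and
the mean of a smooth function of the sum is followed through the exchanges.
Suppose that a bounded function [g] has a second-order expansion
[g (x + y) = g x + a x * y + b x * y ^+ 2] up to an error [E y] that is uniform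
in [x] ([taylor2]).  Averaging this expansion over two centred laws of equal
variance gives the same result up to the averages of [E], so one exchange costs
at most the sum of the means of [E] under the two laws ([average_replacement]),
and a whole block costs the sum of these ([lindeberg_replacement]).

The Gaussian terms are not constructed as random variables.  They enter only
through averaging operators [g |-> (x |-> \int g (x + Y))], and the exchange of
all the terms is an induction on the length of the sum, which rests on three
facts.  First, averaging preserves [taylor2] with the same error [E]
([average_taylor2]): one integrates the inequality, so that nothing has to be
differentiated under an integral.  Second, a partial sum is independent of the
next term ([partial_sum_indep_next]), so that the mean of [g] at the longer sum
is the mean of the averaged [g] at the shorter one
([independent_pair_average]).  Third, two successive centred Gaussian averages
amount to one Gaussian average whose variance is the sum of the two
([Rintegral_normal_prob_rotation]); this is the invariance of the Gaussian
plane under rotations, and it turns the last comparison into an integral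
against the standard normal law.

The test function is a cubic spline [step] that rises from 0 to 1.  Its error is
a multiple of [min(y^2, |y|^3)] ([step_taylor2]), and for every [eps > 0]
[[
  min(y^2, |y|^3) <= eps * y^2 + eps^(-delta) * |y|^(2 + delta).
]]
This inequality covers all [delta > 0] at once, including [delta < 1], where
third moments may be infinite.  Applied to the terms of a block divided by the
standard deviation of their sum, and summed, it bounds their share of the error
by [eps] plus [eps^(-delta)] times the Lyapunov ratio.  A similar inequality for
[y^2] shows that each term carries a small part of the total variance, which
bounds the Gaussian share, a multiple of the sum of the cubes of the normalized
standard deviations.  Both shares are of order [eps] as soon as the ratio is at
most [eps^(2 + delta)] ([block_error_le]).  All these bounds are about one block
with its own standard deviation, and they are uniform in its position.

Finally the distribution function of the normalized sum lies between the means
of two such splines, reversed and shifted by a small [eta], and the normal distribution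
function is Lipschitz, so that the two distribution functions differ by at most
a multiple of [eta] plus an error that tends to 0 for fixed [eta]
([normalized_block_sum_cdf]). *)

(** * Integration against the standard normal law *)

Section gaussian_law.
Context {R : realType}.
Local Notation mu := (@lebesgue_measure R).
Local Notation gamma := (@normal_prob R 0 1).
Local Notation phi := (@normal_pdf R 0 1).

Lemma normal_pdf01E (x : R) :
  phi x = (Num.sqrt (pi *+ 2))^-1 * expR (- (x ^+ 2 / 2)).
Proof.
rewrite normal_pdfE ?oner_eq0//=.
by rewrite /normal_peak /normal_fun expr1n mul1r subr0 mulNr.
Qed.

Lemma measurable_normal_pdfE : measurable_fun [set: R] (EFin \o phi).
Proof. by apply/measurable_EFinP; exact: measurable_normal_pdf. Qed.

Import HBNNSimple.

Let integral_normal_prob_nnsfun (h : {nnsfun measurableTypeR R >-> R}) :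
  (\int[gamma]_x (h x)%:E = \int[mu]_x ((h x)%:E * (phi x)%:E))%E.
Proof.
under [LHS]eq_integral do rewrite fimfunE -fsumEFin//.
rewrite [LHS]ge0_integral_fsum//; last 2 first.
  - by move=> r; exact/measurable_EFinP/measurableT_comp.
  - by move=> n x _; rewrite EFinM nnfun_muleindic_ge0.
under [RHS]eq_integral.
  move=> x xD; rewrite fimfunE -fsumEFin// ge0_mule_fsuml; last first.
    by move=> r; rewrite EFinM nnfun_muleindic_ge0.
  over.
rewrite [RHS]ge0_integral_fsum//; last 2 first.
  - move=> r; apply: emeasurable_funM; last exact: measurable_normal_pdfE.
    by apply/measurable_EFinP; exact/measurableT_comp.
  - move=> n x _; rewrite mule_ge0//; first by rewrite nnfun_muleindic_ge0.
    by rewrite lee_fin normal_pdf_ge0.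
apply: eq_fsbigr => r _.
under [RHS]eq_integral do rewrite EFinM -muleA.
rewrite integralZl_indic_nnsfun//=.
have [r0|r0] := leP 0 r; last first.
  rewrite preimage_nnfun0// integral_indic// set0I measure0 mule0.
  by rewrite integral0_eq// => x _; rewrite indic0 mul0e mule0.
rewrite ge0_integralZl//.
- congr (_ * _)%E; rewrite integral_indic// setIT.
  rewrite [LHS]integral_mkcond; apply: eq_integral => x _; rewrite patchE indicE.
  by case: ifPn => _; rewrite ?mul1e ?mul0e.
- apply: emeasurable_funM; last exact: measurable_normal_pdfE.
  exact/measurable_EFinP.
- by move=> x _; rewrite mule_ge0// lee_fin// normal_pdf_ge0.
Qed.

(** The law is defined by integrating its density over a set, so the formula
holds for indicators; simple functions and monotone limits give the rest. *)
Lemma ge0_integral_normal_prob (f : measurableTypeR R -> \bar R) :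
  measurable_fun setT f -> (forall x, 0 <= f x)%E ->
  (\int[gamma]_x f x = \int[mu]_x (f x * (phi x)%:E))%E.
Proof.
move=> mf f0.
pose f_ := nnsfun_approx measurableT mf.
transitivity (lim (\int[gamma]_x (f_ n x)%:E @[n --> \oo])%E).
  rewrite -monotone_convergence//=.
  - apply: eq_integral => ? /[!inE] xD; apply/esym/cvg_lim => //=.
    exact: cvg_nnsfun_approx.
  - by move=> n; exact/measurable_EFinP/measurable_funTS.
  - by move=> n ? _; rewrite lee_fin.
  - by move=> ? _ ? ? mn; rewrite lee_fin; exact/lefP/nd_nnsfun_approx.
under eq_fun do rewrite integral_normal_prob_nnsfun.
rewrite -monotone_convergence//=.
- apply: eq_integral => x _; apply/cvg_lim => //=.
  by apply: cvgeZr => //; exact: cvg_nnsfun_approx.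
- move=> n; apply: emeasurable_funM; last exact: measurable_normal_pdfE.
  exact/measurable_EFinP/measurable_funTS.
- by move=> n x _; rewrite mule_ge0// lee_fin// normal_pdf_ge0.
- move=> x _ m n mn; rewrite lee_wpmul2r// ?lee_fin ?normal_pdf_ge0//.
  exact/lefP/nd_nnsfun_approx.
Qed.

End gaussian_law.

(** * Moments of the standard normal law *)

(** By parity every moment is an integral over the half-line, where the
unnormalized density [bell] is tractable by finding antiderivatives. *)
Section gaussian_moments.
Context {R : realType}.
Local Notation mu := (@lebesgue_measure R).
Local Notation gamma := (@normal_prob R 0 1).
Local Notation phi := (@normal_pdf R 0 1).
Local Notation bell := (fun z : R => expR (- (z ^+ 2 / 2))).

Lemma is_derive_bell (z : R) : is_derive z 1 bell (- z * bell z).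
Proof.
apply: is_derive_eq.
by rewrite /GRing.scale/=; field.
Qed.

(** Any quadratic factor is beaten by the decay of [bell]: the square of
[expR t >= 1 + t], at [t = z ^+ 2 / 4], has degree four in [z]. *)
Lemma bell_le (z : R) : 1 <= z -> (z ^+ 2 + 2) * bell z <= 16 / z.
Proof.
move=> z1; have z0 : 0 < z by lra.
rewrite expRN ler_pdivlMr// mulrAC ler_pdivrMr ?expR_gt0//.
have h : 1 + z ^+ 2 / 4 <= expR (z ^+ 2 / 4) by exact: expR_ge1Dx.
have -> : z ^+ 2 / 2 = z ^+ 2 / 4 + z ^+ 2 / 4 by field.
rewrite expRD.
apply: (@le_trans _ _ (16 * ((1 + z ^+ 2 / 4) * (1 + z ^+ 2 / 4)))).
  nra.
by rewrite ler_pM2l// ler_pM// addr_ge0// divr_ge0// sqr_ge0.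
Qed.

Lemma cvg_bellM (Q : R -> R) : (forall z, 1 <= z -> `|Q z| <= z ^+ 2 + 2) ->
  Q z * bell z @[z --> +oo] --> (0 : R).
Proof.
move=> Qle; apply/norm_cvg0P.
have h : 16 / z @[z --> +oo] --> (0 : R).
  rewrite -(mulr0 16); apply: cvgMr; apply/gtr0_cvgV0 => //.
  - by near=> z; near: z; exact: nbhs_pinfty_gt.
apply: squeeze_cvgr (cvg_cst 0) h.
near=> z.
have z1 : 1 <= z by near: z; exact: nbhs_pinfty_ge.
rewrite normr_ge0/= normrM (ger0_norm (expR_ge0 _)).
apply: le_trans (bell_le z1).
by rewrite ler_wpM2r ?expR_ge0 ?Qle.
Unshelve. all: by end_near. Qed.

Local Notation halfline := [set z : R | 0 <= z].

(** Nonnegativity of [f] makes the integral over the half-line the limit of the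
integrals over bounded intervals. *)
Lemma bell_FTC2y (f F : R -> R) : (forall z : R, is_derive z 1 F (f z)) ->
    (forall z, 0 <= z -> 0 <= f z) ->
    continuous f -> F z @[z --> +oo] --> (0 : R) ->
  (\int[mu]_(z in halfline) (f z)%:E = (- F 0)%:E)%E.
Proof.
move=> dF f0 cf Foo.
rewrite -set_itvcy (@ge0_continuous_FTC2y _ f F 0 0)//.
- by rewrite sub0e EFinN.
- exact: continuous_subspaceT.
- apply: cvg_at_right_filter; apply: differentiable_continuous.
  by apply/derivable1_diffP; have [] := dF 0.
- by move=> z _; rewrite derive1E; have [] := dF z.
Qed.

Lemma continuous_bell : continuous bell.
Proof.
move=> z; apply: differentiable_continuous.
by apply/derivable1_diffP; have [] := is_derive_bell z.
Qed.

Let continuous_pow n : continuous (fun z : R => z ^+ n).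
Proof. exact: exprn_continuous. Qed.

Lemma integral_bell1 : (\int[mu]_(z in halfline) (z * bell z)%:E = 1)%E.
Proof.
have dF (z : R) : is_derive z 1 (fun z => - 1 * bell z) (z * bell z).
  have ? := is_derive_bell z.
  by apply: is_derive_eq; rewrite /GRing.scale/=; field.
rewrite (bell_FTC2y dF).
- by rewrite expr0n/= mul0r oppr0 expR0 mulr1 opprK.
- by move=> z z0; rewrite mulr_ge0// expR_ge0.
- by move=> z; apply: cvgM; [exact: cvg_id|exact: continuous_bell].
- by apply: (@cvg_bellM (cst (-1))) => z z1/=; rewrite normrN1; nra.
Qed.

Lemma integral_bell3 : (\int[mu]_(z in halfline) (z ^+ 3 * bell z)%:E = 2%:E)%E.
Proof.
have dF (z : R) :
    is_derive z 1 (fun z => - (z ^+ 2 + 2) * bell z) (z ^+ 3 * bell z).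
  have ? := is_derive_bell z.
  by apply: is_derive_eq; rewrite /GRing.scale/=; field.
rewrite (bell_FTC2y dF).
- by rewrite expr0n/= mul0r oppr0 expR0 mulr1 opprK add0r.
- by move=> z z0; rewrite mulr_ge0// ?expR_ge0// exprn_ge0.
- by move=> z; apply: cvgM; [exact: continuous_pow|exact: continuous_bell].
- apply: (@cvg_bellM (fun z => - (z ^+ 2 + 2))) => z z1/=.
  by rewrite normrN ger0_norm//; nra.
Qed.

Lemma ge0_integral_halflineD (f g : R -> R) : continuous f -> continuous g ->
  (forall z, 0 <= z -> 0 <= f z) -> (forall z, 0 <= z -> 0 <= g z) ->
  (\int[mu]_(z in halfline) (f z + g z)%:E =
   \int[mu]_(z in halfline) (f z)%:E + \int[mu]_(z in halfline) (g z)%:E)%E.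
Proof.
move=> cf cg f0 g0; under eq_integral do rewrite EFinD.
have mh : measurable halfline by rewrite -set_itvcy.
by rewrite ge0_integralD//; apply/measurable_EFinP/measurable_funTS;
  exact: continuous_measurable_fun.
Qed.

(** The derivative of [- z * bell z] is [z ^+ 2 * bell z - bell z], which is negative near 0.  Adding [k z = expR (1 - z)], which exceeds [bell] on
[[0, 1]], makes the integrand nonnegative; the integral of [k] is finite and
cancels at the end. *)
Lemma integral_bell2 :
  (\int[mu]_(z in halfline) (z ^+ 2 * bell z)%:E =
   \int[mu]_(z in halfline) (bell z)%:E)%E.
Proof.
pose k (z : R) := expR (1 - z).
have dk (z : R) : is_derive z 1 k (- k z).
  by rewrite /k; apply: is_derive_eq; rewrite /GRing.scale/=; field.
have ck : continuous k.
  move=> z; apply: differentiable_continuous.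
  by apply/derivable1_diffP; have [] := dk z.
have koo : k z @[z --> +oo] --> (0 : R).
  rewrite (_ : k = fun z => expR 1 * expR (- z)); last first.
    by apply/funext => z; rewrite /k expRD.
  by rewrite -(mulr0 (expR 1)); apply: cvgMl_tmp; exact: cvgr_expR.
have k0 z : 0 <= k z by exact: expR_ge0.
have b0 (z : R) : 0 <= bell z by exact: expR_ge0.
have cb2 : continuous (fun z : R => z ^+ 2 * bell z).
  by move=> z; apply: cvgM; [exact: continuous_pow|exact: continuous_bell].
have dNk (z : R) : is_derive z 1 (fun z => - k z) (k z).
  by apply: is_derive_eq; rewrite opprK.
have ik : (\int[mu]_(z in halfline) (k z)%:E = (expR 1)%:E)%E.
  rewrite (bell_FTC2y dNk)//.
  - by rewrite opprK /k subr0.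
  - by rewrite -oppr0; apply: cvgN.
have dF (z : R) : is_derive z 1 (fun z => - z * bell z - k z)
    (z ^+ 2 * bell z - bell z + k z).
  have ? := is_derive_bell z.
  by apply: is_derive_eq; rewrite /GRing.scale/=; field.
have f0 z : 0 <= z -> 0 <= z ^+ 2 * bell z - bell z + k z.
  move=> z0; have [z1|z1] := leP 1 z.
    by rewrite addr_ge0// -[X in _ - X]mul1r -mulrBl mulr_ge0//; nra.
  have b1 : bell z <= 1 by rewrite -[leRHS]expR0 ler_expR; nra.
  have k1 : 1 <= k z by rewrite -[leLHS]expR0 ler_expR; lra.
  have : 0 <= z ^+ 2 * bell z by rewrite mulr_ge0// sqr_ge0.
  by move: b1 k1 => /=; lra.
have cf : continuous (fun z : R => z ^+ 2 * bell z - bell z + k z).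
  move=> z; apply: (@cvgD _ R^o); last exact: ck.
  by apply: (@cvgB _ R^o); [exact: cb2|exact: continuous_bell].
have i2 : (\int[mu]_(z in halfline) (z ^+ 2 * bell z - bell z + k z)%:E =
           (expR 1)%:E)%E.
  rewrite (bell_FTC2y dF)//.
    by rewrite oppr0 mul0r sub0r opprK /k subr0.
  rewrite -(subr0 0); apply: (@cvgB _ R^o) => //.
  by apply: (@cvg_bellM (fun z => - z)) => z z1/=; rewrite normrN ger0_norm; nra.
rewrite -[LHS](@addeK _ (expR 1)%:E)// -[RHS](@addeK _ (expR 1)%:E)//.
congr (_ - _)%E; rewrite -{1}ik -i2 -!ge0_integral_halflineD//.
- by apply: eq_integral => z _; congr EFin; ring.
- exact: continuous_bell.
- by move=> z z0; rewrite mulr_ge0// sqr_ge0.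
Qed.

Local Notation peak := (Num.sqrt (pi *+ 2))^-1.

Lemma ge0_integral_normal_prob_even (h : R -> R) : continuous h ->
    (forall z, 0 <= h z) -> h =1 h \o -%R ->
  (\int[gamma]_z (h z)%:E =
   (2 * peak)%:E * \int[mu]_(z in halfline) (h z * bell z)%:E)%E.
Proof.
move=> ch h0 hN.
have mh : measurable halfline by rewrite -set_itvcy.
have chb : continuous (fun z => h z * bell z).
  by move=> z; apply: cvgM; [exact: ch|exact: continuous_bell].
have hb0 z : 0 <= h z * bell z by rewrite mulr_ge0// expR_ge0.
rewrite ge0_integral_normal_prob//; last first.
  by apply/measurable_EFinP; exact: continuous_measurable_fun.
under eq_integral do rewrite normal_pdf01E -EFinM mulrCA EFinM.
rewrite ge0_integralZl//; last 2 first.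
- by apply/measurable_EFinP; exact: continuous_measurable_fun.
- by move=> z _; rewrite lee_fin.
rewrite ge0_symfun_integralT//; last by move=> z; rewrite /= hN/= sqrrN.
by rewrite EFinM muleA; congr (_ * _)%E; rewrite muleC.
Qed.

Lemma normal_prob_moment2 : (\int[gamma]_z (z ^+ 2)%:E = 1)%E.
Proof.
rewrite ge0_integral_normal_prob_even; last 3 first.
- exact: continuous_pow.
- by move=> z; exact: sqr_ge0.
- by move=> z; rewrite /= sqrrN.
rewrite integral_bell2.
have c1 : continuous (cst 1 : R -> R) by move=> z; exact: cvg_cst.
have := @ge0_integral_normal_prob_even (cst 1) c1 (fun=> ler01) (fun=> erefl).
rewrite (_ : \int[gamma]_z (cst 1 z)%:E = 1)%E; last first.
  transitivity (\int[gamma]_z (cst 1%E z))%E => //.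
  by rewrite integral_cst// mul1e; exact: probability_setT.
move->; congr (_ * _)%E.
by apply: eq_integral => z _; rewrite mul1r.
Qed.

Lemma normal_prob_moment3 :
  (\int[gamma]_z (`|z| ^+ 3)%:E = (4 * peak)%:E)%E.
Proof.
rewrite ge0_integral_normal_prob_even; last 3 first.
- move=> z; apply: (@continuous_comp R R R (fun z => `|z|) (fun y => y ^+ 3)).
    exact: norm_continuous.
  exact: exprn_continuous.
- by move=> z; exact: exprn_ge0.
- by move=> z; rewrite /= normrN.
transitivity ((2 * peak)%:E * \int[mu]_(z in halfline) (z ^+ 3 * bell z)%:E)%E.
  by congr (_ * _)%E; apply: eq_integral => z; rewrite inE/= => /ger0_norm ->.
by rewrite integral_bell3 -EFinM; congr EFin; ring.
Qed.

Lemma normal_prob_absmoment1 :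
  (\int[gamma]_z `|z|%:E = (2 * peak)%:E)%E.
Proof.
rewrite ge0_integral_normal_prob_even; last 3 first.
- exact: norm_continuous.
- by [].
- by move=> z; rewrite /= normrN.
transitivity ((2 * peak)%:E * \int[mu]_(z in halfline) (z * bell z)%:E)%E.
  by congr (_ * _)%E; apply: eq_integral => z; rewrite inE/= => /ger0_norm ->.
by rewrite integral_bell1 mule1.
Qed.

Lemma integrable_normal_prob_id : gamma.-integrable setT (EFin : R -> \bar R).
Proof.
apply/integrableP; split; first exact/measurable_EFinP.
by under eq_integral do rewrite /=; rewrite normal_prob_absmoment1 ltry.
Qed.

(** Writing [z = 2 * max z 0 - |z|] reduces the signed integral to two integrals of
nonnegative functions, both computed on the half-line. *)
Lemma normal_prob_moment1 : (\int[gamma]_z z%:E = 0)%E.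
Proof.
pose zp (z : R) := Num.max z 0.
have zp0 z : 0 <= zp z by rewrite le_max lexx orbT.
have mzp : measurable_fun [set: R] zp.
  exact: measurable_maxr.
have izp : (\int[gamma]_z (zp z)%:E = peak%:E)%E.
  rewrite ge0_integral_normal_prob//; last exact/measurable_EFinP.
  transitivity (\int[mu]_(z in halfline) (peak%:E * (z * bell z)%:E))%E.
    rewrite [RHS]integral_mkcond; apply: eq_integral => z _.
    rewrite patchE /zp normal_pdf01E; case: ifPn; rewrite ?inE ?notin_setE/=.
      by move=> z0; rewrite (max_idPl z0) -!EFinM; congr EFin; ring.
    move=> /negP; rewrite -ltNge => z0.
    by rewrite (max_idPr (ltW z0)) mul0e.
  rewrite ge0_integralZl//.
  - by rewrite integral_bell1 mule1.
  - by rewrite -set_itvcy.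
  - apply/measurable_EFinP/measurable_funTS; apply: continuous_measurable_fun.
    by move=> z; apply: cvgM; [exact: cvg_id|exact: continuous_bell].
  - by move=> z z0; rewrite lee_fin mulr_ge0// expR_ge0.
have zE z : z = 2 * zp z - `|z|.
  rewrite /zp; have [z0|z0] := boolP (0 <= z).
    by rewrite (max_idPl z0) ger0_norm//; ring.
  have {}z0 : z <= 0 by rewrite ltW// ltNge.
  by rewrite (max_idPr z0) ler0_norm//; ring.
transitivity (\int[gamma]_z ((2 * zp z)%:E - `|z|%:E))%E.
  by apply: eq_integral => z _; rewrite -EFinB -zE.
have izpi : gamma.-integrable setT (EFin \o zp).
  apply/integrableP; split; first exact/measurable_EFinP.
  by under eq_integral do rewrite /= ger0_norm//; rewrite izp ltry.
rewrite integralB//=.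
- under eq_integral do rewrite EFinM.
  by rewrite integralZl// izp normal_prob_absmoment1 -EFinM subee.
- by under eq_fun do rewrite EFinM; exact: integrableZl.
- exact: (integrable_norm integrable_normal_prob_id).
Qed.

End gaussian_moments.

(** * Rotation invariance of the Gaussian law *)

Section gaussian_rotation.
Context {R : realType}.
Local Notation mu := (@lebesgue_measure R).
Local Notation gamma := (@normal_prob R 0 1).
Local Notation phi := (@normal_pdf R 0 1).

Lemma ge0_integral_affine (k m : R) (G : R -> R) : 0 < k -> continuous G ->
  (forall z, 0 <= G z) ->
  (\int[mu]_z (G z)%:E = \int[mu]_z (k * G (k * z + m))%:E)%E.
Proof.
move=> k0 cG G0.
pose F (z : R) := k * z + m.
have dF (z : R) : is_derive z 1 F k.
  by rewrite /F; apply: is_derive_eq; rewrite /GRing.scale/=; ring.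
have dFE : F^`()%classic = cst k.
  by apply/funext => z; rewrite derive1E; have [] := dF z.
rewrite (@increasing_ge0_integration_by_substitutionT _ F G)//.
- by apply: eq_integral => z _; rewrite dFE/= !fctE mulrC.
- by move=> x y xy; rewrite /F ltrD2r ltr_pM2l.
- by rewrite dFE => z; exact: cvg_cst.
- by rewrite dFE; exact: is_cvg_cst.
- by rewrite dFE; exact: is_cvg_cst.
- by apply: cvg_comp (cvg_addrr_Ny m); exact: gt0_cvgMrNy.
- by apply: cvg_comp (cvg_addrr m); exact: gt0_cvgMry.
Qed.

(** The map [(u, w) |-> (c / b * u - a / b * w, w)] preserves the quadratic form
[u^2 + (c / b * w - a / b * u)^2], because [c^2 = a^2 + b^2]: complete the
square in [w]. *)
Lemma normal_pdf_rotation (a b c u w : R) : 0 < b -> 0 < c ->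
  c ^+ 2 = a ^+ 2 + b ^+ 2 ->
  phi (c / b * u - a / b * w) * phi w = phi u * phi (c / b * w - a / b * u).
Proof.
move=> b0 c0 abc; rewrite !normal_pdf01E.
rewrite mulrACA [RHS]mulrACA; congr (_ * _); rewrite -!expRD; congr expR.
rewrite -!opprD -!mulrDl; congr (- (_ / _)).
have -> : w ^+ 2 = (c ^+ 2 - a ^+ 2) / b ^+ 2 * w ^+ 2.
  by rewrite abc; field; rewrite gt_eqF.
have -> : u ^+ 2 = (c ^+ 2 - a ^+ 2) / b ^+ 2 * u ^+ 2.
  by rewrite abc; field; rewrite gt_eqF.
by field; rewrite gt_eqF.
Qed.

(** Substitute [a * w + b * z = c * u] for [z], exchange the integrals, and
recognize a normal density in [w], whose integral is 1. *)
Lemma normal_prob_rotation_gt0 (a b c : R) (f : R -> R) :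
  0 < b -> 0 < c -> c ^+ 2 = a ^+ 2 + b ^+ 2 ->
  continuous f -> (forall z, 0 <= f z) ->
  (\int[gamma]_w \int[gamma]_z (f (a * w + b * z))%:E =
   \int[gamma]_z (f (c * z))%:E)%E.
Proof.
move=> b0 c0 abc cf f0.
have cphi : continuous phi by apply: continuous_normal_pdf; exact: oner_neq0.
have phi0 z : 0 <= phi z by exact: normal_pdf_ge0.
have mphi : measurable_fun [set: R] phi by exact: measurable_normal_pdf.
have mf : measurable_fun [set: R] f by exact: continuous_measurable_fun.
have cb0 : 0 < c / b by rewrite divr_gt0.
(* the inner integral, rewritten in the variable u with a w + b z = c u *)
have inner w : (\int[gamma]_z (f (a * w + b * z))%:E =
    \int[mu]_u (c / b * (f (c * u) * phi (c / b * u - a / b * w)))%:E)%E.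
  rewrite ge0_integral_normal_prob; last 2 first.
  - apply/measurable_EFinP; apply: measurableT_comp => //.
    by apply: measurable_funD => //; exact: measurable_funM.
  - by move=> z; rewrite lee_fin.
  rewrite (@ge0_integral_affine (c / b) (- (a / b * w))
    (fun z => f (a * w + b * z) * phi z))//.
  - apply: eq_integral => z _; congr EFin; congr (_ * (f _ * _)).
    by field; rewrite gt_eqF.
  - move=> z; apply: cvgM; last exact: cphi.
    apply: (@continuous_comp R R R (fun z => a * w + b * z) f); last exact: cf.
    by apply: (@cvgD _ R^o); [exact: cvg_cst|apply: cvgM => //; exact: cvg_cst].
  - by move=> z; rewrite mulr_ge0.
under eq_integral do rewrite inner.
pose H (wu : measurableTypeR R * measurableTypeR R) : \bar R :=
  (c / b * (f (c * wu.2) * phi (c / b * wu.2 - a / b * wu.1)))%:E.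
have mH : measurable_fun setT H.
  apply/measurable_EFinP; apply: measurable_funM => //; apply: measurable_funM.
    by apply: measurableT_comp => //; exact: measurable_funM.
  apply: measurableT_comp => //.
  by apply: measurable_funB; exact: measurable_funM.
have H0 wu : (0 <= H wu)%E.
  by rewrite lee_fin; apply: mulr_ge0; [exact: ltW|exact: mulr_ge0].
have mphi1 : measurable_fun setT
    (fun wu : measurableTypeR R * measurableTypeR R => (phi wu.1)%:E).
  by apply/measurable_EFinP; exact: measurableT_comp.
transitivity (\int[mu]_w \int[mu]_u (H (w, u) * (phi w)%:E))%E.
  rewrite ge0_integral_normal_prob; last 2 first.
  - apply: (measurable_fun_fubini_tonelli_F (m2 := mu) H) => //.
  - by move=> w; apply: integral_ge0 => u _; exact: (H0 (w, u)).
  apply: eq_integral => w _; rewrite -ge0_integralZr//.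
  - exact: (measurableT_comp mH (pair1_measurable w)).
  - by move=> u _; exact: (H0 (w, u)).
  - by rewrite lee_fin.
rewrite (fubini_tonelli (fun wu => H wu * (phi wu.1)%:E)%E)/=; last 2 first.
- exact: emeasurable_funM.
- by move=> wu; rewrite mule_ge0// lee_fin.
rewrite [RHS]ge0_integral_normal_prob; last 2 first.
- by apply/measurable_EFinP; apply: measurableT_comp => //; exact: measurable_funM.
- by move=> z; rewrite lee_fin.
apply: eq_integral => u _.
transitivity (\int[mu]_w ((f (c * u) * phi u)%:E *
    (c / b * phi (c / b * w - a / b * u))%:E))%E.
  apply: eq_integral => w _; rewrite -!EFinM; congr EFin.
  have := normal_pdf_rotation u w b0 c0 abc.
  set p := phi (_ - _); set q := phi (_ - _) => pq.
  by rewrite -!mulrA pq; ring.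
rewrite ge0_integralZl//; last 3 first.
- apply/measurable_EFinP; apply: measurable_funM => //.
  by apply: measurableT_comp => //; apply: measurable_funB => //; exact: measurable_funM.
- by move=> w _; rewrite lee_fin mulr_ge0// ltW.
- by rewrite lee_fin mulr_ge0.
by rewrite -ge0_integral_affine// integral_normal_pdf mule1.
Qed.

(** For [b = 0] the substitution degenerates, but the inner integrand is then
constant. *)
Lemma normal_prob_rotation (a b : R) (f : R -> R) : 0 <= a -> 0 <= b ->
  continuous f -> (forall z, 0 <= f z) ->
  (\int[gamma]_w \int[gamma]_z (f (a * w + b * z))%:E =
   \int[gamma]_z (f (Num.sqrt (a ^+ 2 + b ^+ 2) * z))%:E)%E.
Proof.
move=> a0 b0 cf f0.
have [->|bN0] := eqVneq b 0.
  rewrite expr0n/= addr0 sqrtr_sqr ger0_norm//.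
  apply: eq_integral => w _; under eq_integral do rewrite mul0r addr0.
  rewrite (@integral_cst _ _ _ gamma setT measurableT (f (a * w))%:E).
  by rewrite [X in (_ * X)%E](@probability_setT _ _ _ gamma) mule1.
apply: normal_prob_rotation_gt0 => //.
- by rewrite lt0r bN0.
- by rewrite sqrtr_gt0 ltr_wpDl ?sqr_ge0// exprn_even_gt0.
- by rewrite sqr_sqrtr// addr_ge0// sqr_ge0.
Qed.

End gaussian_rotation.

(** * Averages of functions with a second-order expansion *)

(** One constant serves as bound and as Lipschitz constant.  The class is stable
under averages and its members are continuous, hence measurable, which settles
all questions of integrability below. *)
Definition bounded_lipschitz (R : realType) (M : R) (f : R -> R) :=
  (forall x, `|f x| <= M) /\ (forall x y, `|f x - f y| <= M * `|x - y|).

(** The convolution of [f] with the law of [Y], expressed on the sample space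
of [Y]. *)
Definition average d (T : measurableType d) (R : realType)
  (P : probability T R) (Y : T -> R) (f : R -> R) (x : R) :=
  \int[P]_w f (x + Y w).

(** Here [a] and [b] stand for the first derivative of [g] and half of the
second one, but they are only required to give a good expansion, so that the
property can be integrated. *)
Definition taylor2 (R : realType) (E g a b : R -> R) :=
  forall x y, `|g (x + y) - g x - a x * y - b x * y ^+ 2| <= E y.

Section bounded_integrals.
Context d (T : measurableType d) (R : realType) (P : probability T R).

Lemma bounded_integrable (h : T -> R) M : measurable_fun setT h ->
  (forall w, `|h w| <= M) -> P.-integrable setT (EFin \o h).
Proof.
move=> mh hM; apply: (@le_integrable _ _ _ P setT _ _ (EFin \o cst M)) => //.
- exact/measurable_EFinP.
- by move=> w _ /=; rewrite lee_fin (le_trans (hM w))// ler_norm.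
- exact: finite_measure_integrable_cst.
Qed.

Lemma Rintegral_cst_prob (K : R) : \int[P]_w K = K.
Proof. by rewrite Rintegral_cst// [X in fine X](@probability_setT _ _ _ P) mulr1. Qed.

Lemma norm_Rintegral_le (h : T -> R) M : measurable_fun setT h ->
  (forall w, `|h w| <= M) -> `|\int[P]_w h w| <= M.
Proof.
move=> mh hM; have ih := bounded_integrable mh hM.
apply: le_trans (le_normr_Rintegral _ ih) _ => //.
rewrite -[leRHS]Rintegral_cst_prob; apply: le_Rintegral => //.
- exact: (integrable_norm ih).
- exact: finite_measure_integrable_cst.
Qed.

Lemma bounded_lipschitz_continuous M (f : R -> R) :
  bounded_lipschitz M f -> continuous f.
Proof.
move=> [fM fL] x; apply/cvgrPdist_lt => e e0.
have M0 : 0 <= M by exact: le_trans (fM x).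
near=> y; apply: le_lt_trans (fL _ _) _.
have h : `|x - y| < e / (M + 1).
  by near: y; apply: (@cvgr_dist_lt _ R^o) => //; rewrite divr_gt0// ltr_wpDl.
apply: le_lt_trans (_ : _ <= (M + 1) * `|x - y|) _.
  by rewrite ler_wpM2r// lerDl.
by rewrite mulrC -ltr_pdivlMr// ltr_wpDl.
Unshelve. all: by end_near. Qed.

Section average.
Variable Y : T -> R.
Hypothesis mY : measurable_fun setT Y.

Lemma measurable_bl_shift M (f : R -> R) x : bounded_lipschitz M f ->
  measurable_fun setT (fun w => f (x + Y w)).
Proof.
move=> blf; apply: measurableT_comp; last exact: measurable_funD.
by apply: continuous_measurable_fun; exact: bounded_lipschitz_continuous blf.
Qed.

Lemma integrable_bl_shift M (f : R -> R) x : bounded_lipschitz M f ->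
  P.-integrable setT (EFin \o (fun w => f (x + Y w))).
Proof.
move=> blf; apply: (@bounded_integrable _ M); first exact: measurable_bl_shift blf.
by move=> w; case: blf.
Qed.

Lemma average_bounded_lipschitz M (f : R -> R) : bounded_lipschitz M f ->
  bounded_lipschitz M (average P Y f).
Proof.
move=> blf; have [fM fL] := blf; split=> [x|x y].
  by apply: norm_Rintegral_le => //; exact: measurable_bl_shift blf.
rewrite /average -RintegralB//; try exact: integrable_bl_shift blf.
apply: norm_Rintegral_le.
  by apply: measurable_funB; exact: measurable_bl_shift blf.
by move=> w; apply: le_trans (fL _ _) _; rewrite opprD addrACA subrr addr0.
Qed.

(** The expansion at [x + Y w] with the fixed increment [y] holds for every [w];
integrating it in [w] keeps the error. *)
Lemma average_taylor2 M (E g a b : R -> R) :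
  bounded_lipschitz M g -> bounded_lipschitz M a -> bounded_lipschitz M b ->
  taylor2 E g a b ->
  taylor2 E (average P Y g) (average P Y a) (average P Y b).
Proof.
move=> blg bla blb gE x y.
have i1 := integrable_bl_shift (x + y) blg.
have i2 := integrable_bl_shift x blg.
have i3 := integrable_bl_shift x bla.
have i4 := integrable_bl_shift x blb.
rewrite /average -(RintegralZr _ _ i3)// -(RintegralZr _ _ i4)//.
have i3y : P.-integrable setT (EFin \o (fun w => a (x + Y w) * y)).
  by apply: eq_integrable (integrableZr measurableT y i3).
have i4y : P.-integrable setT (EFin \o (fun w => b (x + Y w) * y ^+ 2)).
  by apply: eq_integrable (integrableZr measurableT (y ^+ 2) i4).
have i12 : P.-integrable setT (EFin \o (fun w => g (x + y + Y w) - g (x + Y w))).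
  exact: (integrableB _ i1 i2).
have i123 : P.-integrable setT
    (EFin \o (fun w => g (x + y + Y w) - g (x + Y w) - a (x + Y w) * y)).
  exact: (integrableB _ i12 i3y).
rewrite -!RintegralB//.
apply: norm_Rintegral_le.
  by repeat (apply: measurable_funB); try apply: measurable_funM => //;
    apply: measurable_bl_shift; eassumption.
by move=> w; rewrite (addrAC x); exact: gE.
Qed.

(** The expansion at the fixed point [x] with the random increment [Y]: the
linear term disappears because [Y] is centred. *)
Lemma average_taylor2_moment M (E g a b : R -> R) x :
  bounded_lipschitz M g -> taylor2 E g a b ->
  P.-integrable setT (EFin \o Y) ->
  P.-integrable setT (EFin \o (fun w => Y w ^+ 2)) ->
  P.-integrable setT (EFin \o (E \o Y)) ->
  \int[P]_w Y w = 0 ->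
  `|average P Y g x - g x - b x * \int[P]_w Y w ^+ 2| <= \int[P]_w E (Y w).
Proof.
move=> blg gE iY iY2 iE Y0.
have i1 := integrable_bl_shift x blg.
have ic : P.-integrable setT (EFin \o cst (g x)).
  exact: finite_measure_integrable_cst.
have iaY : P.-integrable setT (EFin \o (fun w => a x * Y w)).
  by apply: eq_integrable (integrableZl measurableT (a x) iY).
have ibY : P.-integrable setT (EFin \o (fun w => b x * Y w ^+ 2)).
  by apply: eq_integrable (integrableZl measurableT (b x) iY2).
have i2 : P.-integrable setT (EFin \o (fun w => g (x + Y w) - g x)).
  exact: (integrableB _ i1 ic).
have i3 : P.-integrable setT (EFin \o (fun w => g (x + Y w) - g x - a x * Y w)).
  exact: (integrableB _ i2 iaY).
have i4 : P.-integrable setT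
    (EFin \o (fun w => g (x + Y w) - g x - a x * Y w - b x * Y w ^+ 2)).
  exact: (integrableB _ i3 ibY).
have -> : average P Y g x - g x - b x * \int[P]_w Y w ^+ 2 =
    \int[P]_w (g (x + Y w) - g x - a x * Y w - b x * Y w ^+ 2).
  rewrite !RintegralB// RintegralZl// RintegralZl// Y0 mulr0 subr0.
  by rewrite Rintegral_cst_prob.
apply: le_trans (le_normr_Rintegral _ i4) _ => //.
by apply: le_Rintegral => //; exact: (integrable_norm i4).
Qed.

End average.
End bounded_integrals.

(** * Independence and sums *)

Section independent_pair.
Context d (T : measurableType d) (R : realType) (P : probability T R).
Variables U V : {RV P >-> R}.

(** The joint law of [U] and [V] is the image of [P] under this map. *)
Definition pair_rv (w : T) : R * R := (U w, V w).

Lemma measurable_pair_rv : measurable_fun setT pair_rv.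
Proof. exact: measurable_fun_pair. Qed.

HB.instance Definition _ := isMeasurableFun.Build _ _ _ _ pair_rv
  measurable_pair_rv.

Let joint := distribution P (pair_rv : {mfun T >-> (R * R)%type}).

Definition independent_pair := forall A C : set R,
  measurable A -> measurable C ->
  P (U @^-1` A `&` V @^-1` C) = (P (U @^-1` A) * P (V @^-1` C))%E.

(** Rectangles determine a measure on the product. *)
Lemma joint_prod : independent_pair -> forall Z, measurable Z ->
  (distribution P U \x distribution P V)%E Z = joint Z.
Proof.
move=> indUV; apply: product_measure_unique => A C mA mC.
exact: indUV.
Qed.

(** If [U], [V] and an event [F] are mutually independent, so are [U + V] and [F].
The joint law of [(U, V)] restricted to [F] and the joint law scaled by [P F]
agree on rectangles with a scaled product measure, hence they coincide, and
[U + V \in A] is a measurable condition on the pair. *)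
Lemma independent_pair_add_event (F : set T) : measurable F ->
  independent_pair ->
  (forall A C : set R, measurable A -> measurable C ->
    P (U @^-1` A `&` V @^-1` C `&` F) =
    (P (U @^-1` A) * P (V @^-1` C) * P F)%E) ->
  forall A : set R, measurable A ->
    P ((fun w => U w + V w)%R @^-1` A `&` F) =
    (P ((fun w => U w + V w)%R @^-1` A) * P F)%E.
Proof.
move=> mF indUV indUVF A mA.
have PF : P F = (fine (P F))%:E by rewrite fineK// fin_num_measure.
pose r : {nonneg R} := NngNum (fine_ge0 (measure_ge0 P F)).
pose nu := pushforward (mrestr P mF)
   (pair_rv : {mfun T >-> (R * R)%type}).
pose Z := [set xy : R * R | A (xy.1 + xy.2)].
have mZ : measurable Z.
  have madd : measurable_fun setT (fun xy : R * R => xy.1 + xy.2).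
    by apply: measurable_funD; [exact: measurable_fst|exact: measurable_snd].
  by rewrite -[Z]setTI; exact: madd.
transitivity (nu Z) => //.
transitivity (mscale r joint Z); last by rewrite /mscale/= -PF muleC.
rewrite -(@product_measure_unique _ _ _ _ _ (mscale r (distribution P U)) (distribution P V)
  (mscale r joint))//; last first.
  by move=> B C mB mC; rewrite /mscale/= -muleA; congr (_ * _)%E; exact: indUV.
rewrite (@product_measure_unique _ _ _ _ _ (mscale r (distribution P U)) (distribution P V)
  nu)//.
move=> B C mB mC.
transitivity ((fine (P F))%:E * P (U @^-1` B) * P (V @^-1` C))%E => //.
by rewrite -PF -muleA muleC -indUVF.
Qed.

(** Fubini for the product law of [(U, V)]. *)
Lemma independent_pair_average M (g : R -> R) : bounded_lipschitz M g ->
  independent_pair ->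
  \int[P]_w g (U w + V w) = \int[P]_w average P V g (U w).
Proof.
move=> blg indUV; have [gM _] := blg.
pose h (xy : R * R) := g (xy.1 + xy.2).
have mg : measurable_fun [set: R] g.
  by apply: continuous_measurable_fun; exact: bounded_lipschitz_continuous blg.
have mh : measurable_fun setT h.
  by apply: measurableT_comp => //; exact: measurable_funD.
have ih : (distribution P U \x distribution P V)%E.-integrable setT (EFin \o h).
  apply: (@bounded_integrable _ _ _ (distribution P U \x distribution P V)%E h M) => //.
  by move=> xy; exact: gM.
congr fine; transitivity (\int[joint]_xy (h xy)%:E)%E.
  rewrite integral_distribution//; first exact/measurable_EFinP.
  apply: (@bounded_integrable _ _ _ P (h \o pair_rv) M).
    exact: measurableT_comp mh measurable_pair_rv.
  by move=> w; exact: gM.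
rewrite (eq_measure_integral (distribution P U \x distribution P V)%E); last first.
  by move=> Z mZ _; apply/esym; exact: joint_prod.
rewrite -integral12_prod_meas1// /fubini_F/=.
have avgE x : (\int[distribution P V]_y (h (x, y))%:E = (average P V g x)%:E)%E.
  have igx : P.-integrable setT (EFin \o (fun w => g (x + V w))).
    exact: integrable_bl_shift blg.
  rewrite (@integral_distribution _ _ _ _ _ P V (fun y => (h (x, y))%:E))//.
    by rewrite /average /Rintegral fineK//; exact: integrable_fin_num.
  by apply/measurable_EFinP; apply: measurableT_comp mh (pair1_measurable x).
under eq_integral do rewrite avgE.
have bla := average_bounded_lipschitz P (measurable_funPT V) blg.
have ma : measurable_fun [set: R] (average P V g).
  by apply: continuous_measurable_fun; exact: bounded_lipschitz_continuous bla.
rewrite (@integral_distribution _ _ _ _ _ P U (EFin \o average P V g))//.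
  exact/measurable_EFinP.
apply: (@bounded_integrable _ _ _ P (average P V g \o U) M).
  exact: measurableT_comp.
by have [bM _] := bla => w; exact: bM.
Qed.

End independent_pair.

Section partial_sums.
Context d (T : measurableType d) (R : realType) (P : probability T R).
Variables (X : nat -> {RV P >-> R}) (m : nat).

Definition partial_sum (j : nat) (w : T) : R := \sum_(m <= k < j) X k w.

Lemma measurable_partial_sum j : measurable_fun [set: T] (partial_sum j).
Proof. by apply: measurable_sum => k; exact: measurable_funP. Qed.

HB.instance Definition _ j := isMeasurableFun.Build _ _ _ _ (partial_sum j)
  (measurable_partial_sum j).

Definition segment_event (B : nat -> set R) (i j : nat) : set T :=
  \bigcap_(k in [set k | (i <= k < j)%N]) (X k @^-1` B k).

Hypothesis m_gt0 : (0 < m)%N.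
Hypothesis X_indep : mutually_independent P [set k | (1 <= k)%N] X.

Lemma measurable_segment_event B i j : (forall k, measurable (B k)) ->
  measurable (segment_event B i j).
Proof.
by move=> mB; apply: bigcap_measurableType => // k _; exact: measurable_funPTI.
Qed.

Lemma segment_event_prob B i j : (m <= i)%N -> (forall k, measurable (B k)) ->
  P (segment_event B i j) = (\prod_(i <= k < j) P (X k @^-1` B k))%E.
Proof.
move=> mi mB; pose J := [fset k in index_iota i j]%fset.
have memJ k : (k \in J) = (i <= k < j)%N by rewrite in_fset mem_index_iota.
rewrite (_ : segment_event B i j = \bigcap_(k in [set` J]) (X k @^-1` B k)).
  rewrite X_indep//; last first.
    by move=> k /=; rewrite memJ => /andP[ik _]; rewrite (leq_trans m_gt0)// (leq_trans mi).
  apply: perm_big; apply: uniq_perm; rewrite ?fset_uniq ?iota_uniq// => k.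
  by rewrite memJ mem_index_iota.
by congr (\bigcap_(k in _) _); apply/seteqP; split=> k /=; rewrite memJ.
Qed.

Lemma segment_eventS B i j : (i < j)%N ->
  segment_event B i j = X i @^-1` B i `&` segment_event B i.+1 j.
Proof.
move=> ij; apply/seteqP; split=> [w wB|w [wi wB] k /=].
  split; first by apply: wB; rewrite /= leqnn.
  by move=> k /= /andP[ik kj]; apply: wB; rewrite /= kj (ltnW ik).
move=> /andP[]; rewrite leq_eqVlt => /predU1P[<-//|ik kj].
by apply: wB; rewrite /= ik.
Qed.

Lemma partial_sumS j : (m <= j)%N ->
  partial_sum j.+1 = fun w => partial_sum j w + X j w.
Proof. by move=> mj; apply/funext => w; rewrite /partial_sum big_nat_recr. Qed.

Lemma segment_event_set B i j C : (i < j)%N ->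
  segment_event (fun k => if k == i then C else B k) i j =
  X i @^-1` C `&` segment_event B i.+1 j.
Proof.
move=> ij; rewrite segment_eventS// eqxx; congr (_ `&` _).
by apply: eq_bigcapr => k /= /andP[ik _]; rewrite gtn_eqF.
Qed.

(** The induction hypothesis of the grouping argument.  All later terms have to
be carried along: the next step moves one of them into the partial sum. *)
Definition indep_later j := forall B l A, (j <= l)%N ->
  (forall k, measurable (B k)) -> measurable A ->
  P (partial_sum j @^-1` A `&` segment_event B j l) =
  (P (partial_sum j @^-1` A) * P (segment_event B j l))%E.

Let indep_later_term j A C B l : (m <= j)%N -> indep_later j -> (j < l)%N ->
  (forall k, measurable (B k)) -> measurable A -> measurable C ->
  P (partial_sum j @^-1` A `&` X j @^-1` C `&` segment_event B j.+1 l) =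
  (P (partial_sum j @^-1` A) * P (X j @^-1` C) * P (segment_event B j.+1 l))%E.
Proof.
move=> mj IHj jl mB mA mC; pose B' k := if k == j then C else B k.
have mB' k : measurable (B' k) by rewrite /B'; case: ifP.
rewrite -setIA -segment_event_set// IHj//; last exact: ltnW.
rewrite -muleA; congr (_ * _)%E; rewrite !segment_event_prob ?(leqW mj)//.
rewrite big_ltn// eqxx; congr (_ * _)%E.
by apply: eq_big_nat => k /andP[jk _]; rewrite gtn_eqF.
Qed.

Let indep_pair_later j : (m <= j)%N -> indep_later j ->
  independent_pair (partial_sum j) (X j).
Proof.
move=> mj IHj A C mA mC.
have := @indep_later_term j A C (fun=> setT) j.+1 mj IHj (ltnSn _)
  (fun=> measurableT) mA mC.
rewrite (_ : segment_event _ _ _ = setT); last first.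
  by apply/seteqP; split=> // w _ k _.
by rewrite setIT (@probability_setT _ _ _ P) mule1.
Qed.

(** Each step adds [X j] to the sum and removes it from the event, by
[independent_pair_add_event]. *)
Lemma partial_sum_indep_later j : (m <= j)%N -> indep_later j.
Proof.
move=> /subnKC <-; elim: (j - m)%N => [|i IHi] B l A jl mB mA.
  rewrite addn0 in jl *.
  have -> : partial_sum m = cst 0.
    by apply/funext => w; rewrite /partial_sum big_geq.
  rewrite preimage_cst; case: ifPn => _.
    by rewrite setTI (@probability_setT _ _ _ P) mul1e.
  by rewrite set0I measure0 mul0e.
rewrite addnS in jl *; rewrite partial_sumS ?leq_addr//.
apply: independent_pair_add_event => //.
- exact: measurable_segment_event.
- by apply: indep_pair_later; rewrite ?leq_addr.
- by move=> A' C mA' mC; apply: indep_later_term; rewrite ?leq_addr.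
Qed.

Lemma partial_sum_indep_next j : (m <= j)%N ->
  independent_pair (partial_sum j) (X j).
Proof. by move=> mj; apply: indep_pair_later => //; exact: partial_sum_indep_later. Qed.

End partial_sums.

(** * Lindeberg's replacement argument *)

Section gaussian_average.
Context {R : realType}.
Local Notation gamma := (@normal_prob R 0 1).
Implicit Types (g : R -> R) (s : R).

Lemma measurable_scale s : measurable_fun [set: measurableTypeR R] (fun z : R => s * z).
Proof. exact: measurable_funM. Qed.

Lemma integrable_bl_scale M g s : bounded_lipschitz M g ->
  gamma.-integrable setT (EFin \o (fun z => g (s * z))).
Proof.
move=> blg; have := integrable_bl_shift gamma (measurable_scale s) 0 blg.
by apply: eq_integrable => // z _ /=; rewrite add0r.
Qed.

(** The rotation formula for a bounded [g], obtained from the one for nonnegative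
functions by adding the bound [M]. *)
Lemma Rintegral_normal_prob_rotation M g (a b : R) : bounded_lipschitz M g ->
    0 <= a -> 0 <= b ->
  \int[gamma]_w average gamma (fun z => b * z) g (a * w) =
  \int[gamma]_z g (Num.sqrt (a ^+ 2 + b ^+ 2) * z).
Proof.
move=> blg a0 b0; have [gM gL] := blg.
have cg := bounded_lipschitz_continuous blg.
have bla := average_bounded_lipschitz gamma (measurable_scale b) blg.
have shiftE (h : R -> R) : gamma.-integrable setT (EFin \o h) ->
    (\int[gamma]_z (h z + M)%:E = (\int[gamma]_z h z + M)%:E)%E.
  move=> ih; have iM : gamma.-integrable setT (EFin \o cst M).
    exact: finite_measure_integrable_cst.
  rewrite -[X in (_ + X)%:E](Rintegral_cst_prob gamma) -RintegralD//.
  rewrite /Rintegral fineK//; apply: integrable_fin_num => //.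
  exact: (integrableD _ ih iM).
have cgM : continuous (fun x => g x + M).
  by move=> x; apply: (@cvgD _ R^o); [exact: cg|exact: cvg_cst].
have gM0 x : 0 <= g x + M.
  by rewrite -lerBlDr sub0r; have := gM x; rewrite ler_norml => /andP[].
have := normal_prob_rotation a0 b0 cgM gM0.
rewrite shiftE; last exact: integrable_bl_scale blg.
have innerE w : (\int[gamma]_z (g (a * w + b * z) + M)%:E =
    (average gamma (fun z => b * z) g (a * w) + M)%:E)%E.
  by rewrite shiftE//; exact: (integrable_bl_shift gamma (measurable_scale b) _ blg).
under eq_integral do rewrite innerE.
rewrite shiftE; last exact: integrable_bl_scale bla.
by move=> [] /addIr.
Qed.

End gaussian_average.

Section lindeberg.
Context d (T : measurableType d) (R : realType) (P : probability T R).
Local Notation gamma := (@normal_prob R 0 1).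
Variables (X : nat -> {RV P >-> R}) (m : nat) (E : R -> R).
Hypothesis m_gt0 : (0 < m)%N.
Hypothesis X_indep : mutually_independent P [set k | (1 <= k)%N] X.

Local Notation variance k := (\int[P]_w X k w ^+ 2).
Local Notation sd k := (Num.sqrt (variance k)).

Hypothesis X_int : forall k, (m <= k)%N -> P.-integrable setT (EFin \o X k).
Hypothesis X_int2 : forall k, (m <= k)%N ->
  P.-integrable setT (EFin \o (fun w => X k w ^+ 2)).
Hypothesis X_mean : forall k, (m <= k)%N -> \int[P]_w X k w = 0.
Hypothesis E_int : forall k, (m <= k)%N ->
  P.-integrable setT (EFin \o (E \o X k)).
Hypothesis E_int_gauss : forall s, 0 <= s ->
  gamma.-integrable setT (EFin \o (fun z => E (s * z))).

Lemma variance_ge0 k : 0 <= variance k.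
Proof. by apply: Rintegral_ge0 => w _; exact: sqr_ge0. Qed.

Lemma integrable_normal_prob_sqr : gamma.-integrable setT
  (EFin \o (fun z : R => z ^+ 2)).
Proof.
apply/integrableP; split.
  by apply/measurable_EFinP; exact: measurable_funX.
under eq_integral do rewrite /= ger0_norm ?sqr_ge0//.
by rewrite normal_prob_moment2 ltry.
Qed.

(** The two averages share the terms [g x] and [b x * variance k], since both laws
are centred with the same variance; only the errors remain. *)
Lemma average_replacement k M g a b x : (m <= k)%N ->
  bounded_lipschitz M g -> taylor2 E g a b ->
  `|average P (X k) g x - average gamma (fun z => sd k * z) g x| <=
  \int[P]_w E (X k w) + \int[gamma]_z E (sd k * z).
Proof.
move=> mk blg gE.
have hX := @average_taylor2_moment _ _ _ P (X k) (measurable_funPT _) M E g a b x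
  blg gE (X_int mk) (X_int2 mk) (E_int mk) (X_mean mk).
have iid := @integrable_normal_prob_id R.
have isq := integrable_normal_prob_sqr.
have iY : gamma.-integrable setT (EFin \o (fun z => sd k * z)).
  exact: (integrableZl measurableT (sd k) iid).
have sqE z : (sd k * z) ^+ 2 = variance k * z ^+ 2.
  by rewrite exprMn sqr_sqrtr// variance_ge0.
have iY2 : gamma.-integrable setT (EFin \o (fun z => (sd k * z) ^+ 2)).
  rewrite (_ : (fun z => _) = (fun z => variance k * z ^+ 2)); last first.
    by apply/funext => z; rewrite sqE.
  exact: (integrableZl measurableT (variance k) isq).
have Y0 : \int[gamma]_z (sd k * z) = 0.
  by rewrite RintegralZl// /Rintegral normal_prob_moment1 mulr0.
have Y2 : \int[gamma]_z (sd k * z) ^+ 2 = variance k.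
  transitivity (\int[gamma]_z (variance k * z ^+ 2)).
    by apply: eq_Rintegral => z _; rewrite sqE.
  by rewrite RintegralZl// {2}/Rintegral normal_prob_moment2 mulr1.
have hG := @average_taylor2_moment _ _ _ gamma (fun z => sd k * z) (measurable_scale (sd k))
  M E g a b x blg gE iY iY2 (E_int_gauss (sqrtr_ge0 _)) Y0.
move: hX hG; rewrite Y2 -!addrA -!opprD => hX hG.
apply: le_trans (ler_distD (g x + b x * variance k) _ _) _.
by rewrite lerD// distrC.
Qed.

Local Notation total_sd j := (Num.sqrt (\sum_(m <= k < j) variance k)).

(** Induction on [j].  With [l] the last index, the mean of [g] at the full sum is
the mean of [average P (X l) g] at the shorter one, to which the induction
hypothesis applies; the result is compared with the Gaussian average of [g]
pointwise, and the two Gaussian averages merge by rotation. *)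
Lemma lindeberg_replacement j M g a b : (m <= j)%N ->
  bounded_lipschitz M g -> bounded_lipschitz M a -> bounded_lipschitz M b ->
  taylor2 E g a b ->
  `|\int[P]_w g (partial_sum X m j w) - \int[gamma]_z g (total_sd j * z)| <=
  \sum_(m <= k < j) (\int[P]_w E (X k w) + \int[gamma]_z E (sd k * z)).
Proof.
move=> /subnKC <-; elim: (j - m)%N => [|i IHi] in g a b *; move=> blg bla blb gE.
  rewrite addn0 !big_geq// sqrtr0.
  have -> : \int[P]_w g (partial_sum X m m w) = g 0.
    rewrite -[RHS](Rintegral_cst_prob P); apply: eq_Rintegral => w _.
    by rewrite /partial_sum big_geq.
  have -> : \int[gamma]_z g (0 * z) = g 0.
    rewrite -[RHS](Rintegral_cst_prob gamma); apply: eq_Rintegral => w _.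
    by rewrite mul0r.
  by rewrite subrr normr0.
rewrite addnS; set l := (m + i)%N in IHi *.
have ml : (m <= l)%N by exact: leq_addr.
rewrite big_nat_recr//= [X in _ <= X]big_nat_recr//=.
have sum0 : 0 <= \sum_(m <= k < l) variance k.
  by apply: sumr_ge0 => k _; exact: variance_ge0.
have -> : \int[P]_w g (partial_sum X m l.+1 w) =
    \int[P]_w average P (X l) g (partial_sum X m l w).
  rewrite (partial_sumS X ml).
  apply: independent_pair_average blg _.
  exact: (partial_sum_indep_next m_gt0 X_indep ml).
have := Rintegral_normal_prob_rotation blg (sqrtr_ge0 (\sum_(m <= k < l) variance k))
  (sqrtr_ge0 (variance l)).
rewrite !sqr_sqrtr ?variance_ge0// => <-.
have blT := average_bounded_lipschitz P (measurable_funPT (X l)) blg.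
have blG := average_bounded_lipschitz gamma (measurable_scale (sd l)) blg.
have := IHi _ _ _ blT (average_bounded_lipschitz P (measurable_funPT (X l)) bla)
  (average_bounded_lipschitz P (measurable_funPT (X l)) blb)
  (average_taylor2 P (measurable_funPT (X l)) blg bla blb gE).
set e := \sum_(_ <= _ < _) _.
have : `|\int[gamma]_z average P (X l) g (total_sd l * z) -
         \int[gamma]_z average gamma (fun z => sd l * z) g (total_sd l * z)| <=
       \int[P]_w E (X l w) + \int[gamma]_z E (sd l * z).
  rewrite -RintegralB//; try by apply: integrable_bl_scale; eassumption.
  apply: norm_Rintegral_le; last by move=> z; exact: average_replacement blg gE.
  apply: measurable_funB; apply: measurableT_comp (measurable_scale _);
    apply: continuous_measurable_fun; apply: bounded_lipschitz_continuous; eassumption.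
move=> one IH.
apply: le_trans (ler_distD (\int[gamma]_z average P (X l) g (total_sd l * z)) _ _) _.
exact: lerD.
Qed.

End lindeberg.

(** * A cubic spline as a smooth step *)

Section spline.
Context {R : realType}.
Implicit Types x y t : R.

(** The case [n = 0] is the constant 1, not the indicator of the half-line. *)
Definition truncated_power (n : nat) x : R := Num.max x 0 ^+ n.
Local Notation tp := truncated_power.

Lemma truncated_power_pos n x : 0 <= x -> tp n x = x ^+ n.
Proof. by move=> x0; rewrite /tp (max_idPl x0). Qed.

Lemma truncated_power_neg n x : x <= 0 -> tp n.+1 x = 0.
Proof. by move=> x0; rewrite /tp (max_idPr x0) expr0n. Qed.

(** A third difference kills quadratic polynomials and sends the cube to the
constant 6.  On truncated powers this yields functions that are constant away
from [[0, 3]]. *)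
Definition difference3 (f : R -> R) x := f x - 3 * f (x - 1) + 3 * f (x - 2) - f (x - 3).

(** The integral of the quadratic B-spline on the knots 0, 1, 2, 3. *)
Definition step x := difference3 (tp 3) x / 6.
Definition step_deriv x := difference3 (tp 2) x / 2.
(** Half of the second derivative of [step], as in [taylor2]; hence the factor is
[3 * 2 / 6 / 2]. *)
Definition step_half_deriv2 x := difference3 (tp 1) x / 2.

Let tpp := truncated_power_pos.
Let tpn := truncated_power_neg.

Lemma difference3_01 n x : 0 <= x -> x <= 1 -> difference3 (tp n.+1) x = x ^+ n.+1.
Proof.
by move=> x0 x1; rewrite /difference3 tpp// !tpn; first ring; lra.
Qed.

Lemma difference3_12 n x : 1 <= x -> x <= 2 ->
  difference3 (tp n.+1) x = x ^+ n.+1 - 3 * (x - 1) ^+ n.+1.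
Proof.
move=> x1 x2; rewrite /difference3 (tpp _ (_ : 0 <= x)) ?(tpp _ (_ : 0 <= x - 1)).
by rewrite !tpn; first ring; lra.
all: lra.
Qed.

Lemma difference3_23 n x : 2 <= x -> x <= 3 ->
  difference3 (tp n.+1) x =
  x ^+ n.+1 - 3 * (x - 1) ^+ n.+1 + 3 * (x - 2) ^+ n.+1.
Proof.
move=> x2 x3; rewrite /difference3 3?tpp ?tpn; first ring.
all: lra.
Qed.

Lemma step_le0 x : x <= 0 -> step x = 0.
Proof. by move=> x0; rewrite /step /difference3 !tpn; lra. Qed.

Lemma step_ge3 x : 3 <= x -> step x = 1.
Proof. by move=> x3; rewrite /step /difference3 !tpp; lra. Qed.

Lemma step_deriv_le0 x : x <= 0 -> step_deriv x = 0.
Proof. by move=> x0; rewrite /step_deriv /difference3 !tpn; lra. Qed.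

Lemma step_deriv_ge3 x : 3 <= x -> step_deriv x = 0.
Proof. by move=> x3; rewrite /step_deriv /difference3 !tpp; lra. Qed.

Lemma step_half_deriv2_le0 x : x <= 0 -> step_half_deriv2 x = 0.
Proof. by move=> x0; rewrite /step_half_deriv2 /difference3 !tpn; lra. Qed.

Lemma step_half_deriv2_ge3 x : 3 <= x -> step_half_deriv2 x = 0.
Proof. by move=> x3; rewrite /step_half_deriv2 /difference3 !tpp; lra. Qed.

(** On [[1, 2]] the two bounds are the factorizations given to the solver, and on
[[2, 3]] the value is [1 - (3 - x) ^+ 3 / 6]. *)
Lemma step_bounds x : 0 <= step x <= 1.
Proof.
have [x0|/ltW x0] := leP x 0; first by rewrite step_le0//; lra.
have [x3|/ltW x3] := leP 3 x; first by rewrite step_ge3//; lra.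
rewrite /step; have [x1|/ltW x1] := leP x 1.
  rewrite difference3_01//.
  have : 0 <= x ^+ 3 <= 1 by rewrite exprn_ge0//= exprn_ile1.
  lra.
have [x2|/ltW x2] := leP x 2.
  rewrite difference3_12//.
  have : 0 <= (x - 1) ^+ 2 * (2 - x) by rewrite mulr_ge0 ?sqr_ge0//; lra.
  have : 0 <= (2 - x) ^+ 2 * (2 * x - 1) by rewrite mulr_ge0 ?sqr_ge0//; lra.
  nra.
rewrite difference3_23//.
have : 0 <= (3 - x) ^+ 3 <= 1.
  by rewrite exprn_ge0 ?exprn_ile1//; lra.
nra.
Qed.

Lemma step_deriv_bounded x : `|step_deriv x| <= 1.
Proof.
have [x0|/ltW x0] := leP x 0; first by rewrite step_deriv_le0// normr0; lra.
have [x3|/ltW x3] := leP 3 x; first by rewrite step_deriv_ge3// normr0; lra.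
rewrite /step_deriv ler_norml; have [x1|/ltW x1] := leP x 1.
  by rewrite difference3_01//; nra.
have [x2|/ltW x2] := leP x 2.
  by rewrite difference3_12//; nra.
by rewrite difference3_23//; nra.
Qed.

Lemma step_half_deriv2_bounded x : `|step_half_deriv2 x| <= 1.
Proof.
have [x0|/ltW x0] := leP x 0; first by rewrite step_half_deriv2_le0// normr0; lra.
have [x3|/ltW x3] := leP 3 x; first by rewrite step_half_deriv2_ge3// normr0; lra.
rewrite /step_half_deriv2 ler_norml; have [x1|/ltW x1] := leP x 1.
  by rewrite difference3_01//; lra.
have [x2|/ltW x2] := leP x 2.
  by rewrite difference3_12//; lra.
by rewrite difference3_23//; lra.
Qed.

(** The remainder is [y ^+ 3] or 0 when [x] and [x + y] are on the same side of 0;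
otherwise it is dominated by [y ^+ 3] because [0] lies between them. *)
Lemma truncated_cube_taylor x y :
  `|tp 3 (x + y) - tp 3 x - 3 * tp 2 x * y - 3 * tp 1 x * y ^+ 2| <= `|y| ^+ 3.
Proof.
have [x0|/ltW x0] := leP 0 x; have [xy0|/ltW xy0] := leP 0 (x + y).
- rewrite !tpp// -normrX [X in `|X| <= _](_ : _ = y ^+ 3)//; ring.
- rewrite !(tpp _ x0) tpn// -normrX.
  have y0 : y <= 0 by lra.
  have xy3 : (x + y) ^+ 3 <= 0 by rewrite exprn_odd_le0.
  have y3 : y ^+ 3 <= (x + y) ^+ 3.
    have : (- (x + y)) ^+ 3 <= (- y) ^+ 3 by rewrite lerXn2r ?nnegrE; lra.
    lra.
  rewrite (ler0_norm (le_trans y3 xy3)) [X in `|X|](_ : _ = y ^+ 3 - (x + y) ^+ 3).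
    by rewrite ler0_norm; lra.
  by ring.
- rewrite !(tpn _ x0) tpp// !mulr0 !mul0r !subr0 ger0_norm ?exprn_ge0//.
  by rewrite ger0_norm; [rewrite lerXn2r ?nnegrE|]; lra.
- by rewrite !tpn// !mulr0 !mul0r !subr0 normr0 exprn_ge0.
Qed.

Lemma truncated_square_taylor x y :
  `|tp 2 (x + y) - tp 2 x - 2 * tp 1 x * y| <= `|y| ^+ 2.
Proof.
rewrite real_normK ?num_real// ler_norml.
have [x0|/ltW x0] := leP 0 x; have [xy0|/ltW xy0] := leP 0 (x + y).
- by rewrite !tpp//; nra.
- by rewrite !(tpp _ x0) tpn//; nra.
- by rewrite !(tpn _ x0) tpp//; nra.
- by rewrite !tpn//; nra.
Qed.

Lemma truncated_line_lipschitz x y : `|tp 1 x - tp 1 y| <= `|x - y|.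
Proof.
have [x0|/ltW x0] := leP 0 x; have [y0|/ltW y0] := leP 0 y.
- by rewrite !tpp.
- rewrite (tpp _ x0) (tpn _ y0) subr0 expr1 !ger0_norm//; lra.
- rewrite (tpn _ x0) (tpp _ y0) sub0r expr1 normrN ger0_norm// ler0_norm; lra.
- by rewrite !tpn// subrr normr0.
Qed.

Lemma step_taylor x y :
  `|step (x + y) - step x - step_deriv x * y - step_half_deriv2 x * y ^+ 2| <= 2 * `|y| ^+ 3.
Proof.
rewrite /step /step_deriv /step_half_deriv2 /difference3 !(addrAC x y).
have := truncated_cube_taylor x y; have := truncated_cube_taylor (x - 1) y.
have := truncated_cube_taylor (x - 2) y; have := truncated_cube_taylor (x - 3) y.
have : 0 <= `|y| ^+ 3 by rewrite exprn_ge0.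
move: (`|y| ^+ 3) => e; rewrite !ler_norml.
move=> e0 /andP[? ?] /andP[? ?] /andP[? ?] /andP[? ?]; apply/andP; split; lra.
Qed.

Lemma step_deriv_taylor x y :
  `|step_deriv (x + y) - step_deriv x - 2 * step_half_deriv2 x * y| <= 4 * `|y| ^+ 2.
Proof.
rewrite /step_deriv /step_half_deriv2 /difference3 !(addrAC x y).
have := truncated_square_taylor x y; have := truncated_square_taylor (x - 1) y.
have := truncated_square_taylor (x - 2) y.
have := truncated_square_taylor (x - 3) y.
have : 0 <= `|y| ^+ 2 by rewrite exprn_ge0.
move: (`|y| ^+ 2) => e; rewrite !ler_norml.
move=> e0 /andP[? ?] /andP[? ?] /andP[? ?] /andP[? ?]; apply/andP; split; lra.
Qed.

(** Increments larger than 1 are controlled by the bound on [f]. *)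
Lemma bounded_lipschitz_local K L (f : R -> R) : 0 <= K -> 0 <= L ->
  (forall x, `|f x| <= K) ->
  (forall x y, `|y| <= 1 -> `|f (x + y) - f x| <= L * `|y|) ->
  bounded_lipschitz (2 * K + L) f.
Proof.
move=> K0 L0 fK fL; split=> [x|x y]; first by have := fK x; lra.
have -> : x = y + (x - y) by ring.
set z := x - y; have -> : y + z - y = z by ring.
have z0 : 0 <= `|z| by [].
have [z1|/ltW z1] := leP `|z| 1.
  by have := fL y z z1; have := mulr_ge0 K0 z0; lra.
apply: le_trans (ler_normB _ _) _; have := fK (y + z); have := fK y.
by have := mulr_ge0 L0 z0; nra.
Qed.

Lemma step_increment x y : `|step (x + y) - step x| <= 1.
Proof.
have := step_bounds (x + y); have := step_bounds x.
by rewrite ler_norml => /andP[? ?] /andP[? ?]; apply/andP; split; lra.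
Qed.

Lemma step_linear_term x y : `|step_deriv x * y| <= `|y|.
Proof. by rewrite normrM ler_piMl// step_deriv_bounded. Qed.

Lemma step_quadratic_term x y : `|step_half_deriv2 x * y ^+ 2| <= `|y| ^+ 2.
Proof. by rewrite normrM normrX ler_piMl ?step_half_deriv2_bounded// exprn_ge0. Qed.

Lemma step_bounded_lipschitz : bounded_lipschitz 8 step.
Proof.
have -> : 8 = 2 * 1 + 6 :> R by ring.
apply: bounded_lipschitz_local => // [x|x y y1].
  by have /andP[? ?] := step_bounds x; rewrite ger0_norm.
have -> : step (x + y) - step x =
    step (x + y) - step x - step_deriv x * y - step_half_deriv2 x * y ^+ 2 +
    (step_deriv x * y + step_half_deriv2 x * y ^+ 2) by ring.
apply: le_trans (ler_normD _ _) _.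
apply: le_trans (lerD (step_taylor x y) (ler_normD _ _)) _.
have := step_linear_term x y; have := step_quadratic_term x y.
have y0 : 0 <= `|y| by [].
have y2 : `|y| ^+ 2 <= `|y| by nra.
have y3 : `|y| ^+ 3 <= `|y| by nra.
lra.
Qed.

Lemma step_deriv_bounded_lipschitz : bounded_lipschitz 8 step_deriv.
Proof.
have -> : 8 = 2 * 1 + 6 :> R by ring.
apply: bounded_lipschitz_local => // [x|x y y1]; first exact: step_deriv_bounded.
have -> : step_deriv (x + y) - step_deriv x =
    step_deriv (x + y) - step_deriv x - 2 * step_half_deriv2 x * y + 2 * (step_half_deriv2 x * y) by ring.
apply: le_trans (ler_normD _ _) _.
apply: le_trans (lerD (step_deriv_taylor x y) (lexx _)) _.
have : `|step_half_deriv2 x * y| <= `|y| by rewrite normrM ler_piMl// step_half_deriv2_bounded.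
rewrite (normrM 2) normr_nat.
have y0 : 0 <= `|y| by [].
have y2 : `|y| ^+ 2 <= `|y| by nra.
lra.
Qed.

Lemma step_half_deriv2_bounded_lipschitz : bounded_lipschitz 8 step_half_deriv2.
Proof.
split=> [x|x y]; first by have := step_half_deriv2_bounded x; lra.
rewrite /step_half_deriv2 /difference3.
have h c : `|tp 1 (x - c) - tp 1 (y - c)| <= `|x - y|.
  apply: le_trans (truncated_line_lipschitz _ _) _.
  by rewrite opprB addrA subrK.
have := truncated_line_lipschitz x y; have := h 1; have := h 2; have := h 3.
have : 0 <= `|x - y| by [].
move: `|x - y| => e; rewrite !ler_norml.
move=> e0 /andP[? ?] /andP[? ?] /andP[? ?] /andP[? ?]; apply/andP; split; lra.
Qed.

(** The cubic remainder governs small increments; the quadratic bound replaces it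
for large ones, so that second moments suffice for integrability. *)
Definition cubic_error y : R := Num.min (y ^+ 2) (`|y| ^+ 3).

(** For [|y| >= 1] the increment, the linear term and the quadratic term are each
at most [y ^+ 2] in absolute value, whence the factor 3. *)
Lemma step_taylor2 : taylor2 (fun y => 3 * cubic_error y) step step_deriv step_half_deriv2.
Proof.
move=> x y; rewrite /cubic_error.
have y0 : 0 <= `|y| by [].
rewrite -{2}(real_normK (num_real y)).
have [y1|/ltW y1] := leP `|y| 1.
  rewrite (min_idPr _); last by nra.
  have := step_taylor x y; have : 0 <= `|y| ^+ 3 by rewrite exprn_ge0.
  have -> : y ^+ 2 = `|y| ^+ 2 by rewrite real_normK// num_real.
  lra.
rewrite (min_idPl _); last by nra.
have -> : step (x + y) - step x - step_deriv x * y - step_half_deriv2 x * y ^+ 2 =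
    step (x + y) - step x - (step_deriv x * y + step_half_deriv2 x * y ^+ 2) by ring.
apply: le_trans (ler_normB _ _) _.
apply: le_trans (lerD (step_increment x y) (ler_normD _ _)) _.
have := step_linear_term x y; have := step_quadratic_term x y; nra.
Qed.

Lemma bounded_lipschitz_affine M (f : R -> R) k l c : bounded_lipschitz M f ->
  bounded_lipschitz (M * `|k| * (1 + `|l|)) (fun x => k * f (l * x + c)).
Proof.
move=> [fM fL]; have M0 : 0 <= M by exact: le_trans (fM 0).
have kl : 0 <= M * `|k| * `|l| by rewrite !mulr_ge0.
have k0 : 0 <= M * `|k| by rewrite mulr_ge0.
split=> [x|x y].
  rewrite normrM; have := ler_wpM2l (normr_ge0 k) (fM (l * x + c)); lra.
rewrite -mulrBr normrM.
apply: le_trans (ler_wpM2l (normr_ge0 k) (fL _ _)) _.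
have -> : l * x + c - (l * y + c) = l * (x - y) by ring.
have := mulr_ge0 k0 (normr_ge0 (x - y)); rewrite normrM; lra.
Qed.

Lemma bounded_lipschitz_le M M' (f : R -> R) : M <= M' ->
  bounded_lipschitz M f -> bounded_lipschitz M' f.
Proof.
move=> MM' [fM fL]; split=> [x|x y]; first exact: le_trans (fM x) _.
by apply: le_trans (fL x y) _; exact: ler_wpM2r.
Qed.

Lemma taylor2_affine (e g a b : R -> R) l c : taylor2 e g a b ->
  taylor2 (fun y => e (l * y)) (fun x => g (l * x + c))
    (fun x => l * a (l * x + c)) (fun x => l ^+ 2 * b (l * x + c)).
Proof.
move=> h x y; have := h (l * x + c) (l * y).
have -> : l * x + c + l * y = l * (x + y) + c by ring.
by congr (`| _ | <= _); ring.
Qed.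

Lemma cubic_error_ge0 y : 0 <= cubic_error y.
Proof. by rewrite le_min sqr_ge0 exprn_ge0. Qed.

Lemma cubic_error_le2 y : cubic_error y <= y ^+ 2.
Proof. by rewrite ge_min lexx. Qed.

Lemma cubic_error_le3 y : cubic_error y <= `|y| ^+ 3.
Proof. by rewrite ge_min lexx orbT. Qed.

Lemma cubic_error_scale l y :
  cubic_error (l * y) <= (l ^+ 2 + `|l| ^+ 3) * cubic_error y.
Proof.
have l2 := sqr_ge0 l; have l3 : 0 <= `|l| ^+ 3 by exact: exprn_ge0.
have c0 := cubic_error_ge0 y.
rewrite {2}/cubic_error.
have [h|/ltW h] := leP (y ^+ 2) (`|y| ^+ 3).
  apply: le_trans (cubic_error_le2 _) _; rewrite exprMn.
  by rewrite ler_wpM2r ?sqr_ge0// lerDl.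
apply: le_trans (cubic_error_le3 _) _; rewrite normrM exprMn.
by rewrite ler_wpM2r ?exprn_ge0// lerDr.
Qed.

Lemma measurable_cubic_error : measurable_fun [set: R] cubic_error.
Proof.
apply: measurable_minr; first exact: measurable_funX.
by apply: measurable_funX; exact: normr_measurable.
Qed.

End spline.

(** * Truncation by the moment of order 2 + delta *)

Section lyapunov_pointwise.
Context {R : realType}.
Implicit Types (u eps delta : R).

Lemma sqr_le_powR_tail u eps delta : 0 < eps -> 0 < delta -> eps <= `|u| ->
  u ^+ 2 <= (eps `^ delta)^-1 * `|u| `^ (2 + delta).
Proof.
move=> e0 d0 eu; have u0 : 0 < `|u| by exact: lt_le_trans eu.
rewrite powRD; last by rewrite (gt_eqF u0) implybT.
rewrite powR_mulrn// real_normK ?num_real//.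
rewrite mulrCA ler_peMr ?sqr_ge0//.
by rewrite mulrC ler_pdivlMr ?powR_gt0// mul1r ge0_ler_powR ?nnegrE// ltW.
Qed.

Lemma sqr_le_powR u eps delta : 0 < eps -> 0 < delta ->
  u ^+ 2 <= eps ^+ 2 + (eps `^ delta)^-1 * `|u| `^ (2 + delta).
Proof.
move=> e0 d0; have e2 := sqr_ge0 eps.
have pu0 : 0 <= (eps `^ delta)^-1 * `|u| `^ (2 + delta).
  by rewrite mulr_ge0 ?powR_ge0// invr_ge0 powR_ge0.
have [ue|/ltW eu] := leP `|u| eps.
  rewrite -[leLHS]addr0 lerD// -(real_normK (num_real u)).
  by rewrite lerXn2r ?nnegrE// ltW.
by have := sqr_le_powR_tail e0 d0 eu; lra.
Qed.

(** Below [eps] the cube is at most [eps * u ^+ 2]; above [eps] the square is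
dominated by the moment of order [2 + delta]. *)
Lemma cubic_error_le_powR u eps delta : 0 < eps -> 0 < delta ->
  cubic_error u <= eps * u ^+ 2 + (eps `^ delta)^-1 * `|u| `^ (2 + delta).
Proof.
move=> e0 d0.
have pu0 : 0 <= (eps `^ delta)^-1 * `|u| `^ (2 + delta).
  by rewrite mulr_ge0 ?powR_ge0// invr_ge0 powR_ge0.
have [ue|/ltW eu] := leP `|u| eps.
  apply: le_trans (cubic_error_le3 u) _.
  rewrite -[leLHS]addr0 lerD// -(real_normK (num_real u)) exprS.
  by rewrite ler_wpM2r// exprn_ge0.
apply: le_trans (cubic_error_le2 u) _.
apply: le_trans (sqr_le_powR_tail e0 d0 eu) _.
by rewrite lerDr mulr_ge0 ?sqr_ge0// ltW.
Qed.

Lemma powR_normM_inv u s p : 0 < s -> `|u / s| `^ p = (s `^ p)^-1 * `|u| `^ p.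
Proof.
move=> s0; have -> : `|u| = s * `|u / s|.
  by rewrite -{1}(gtr0_norm s0) -normrM mulrC divfK// gt_eqF.
by rewrite (powRM _ (ltW s0) (normr_ge0 _)) mulrA mulVf ?mul1r// gt_eqF// powR_gt0.
Qed.

End lyapunov_pointwise.

Section block_error.
Context d (T : measurableType d) (R : realType) (P : probability T R).
Local Notation gamma := (@normal_prob R 0 1).

Section moments.
Variables (Y : {RV P >-> R}) (delta : R).
Hypothesis delta_gt0 : 0 < delta.

Lemma measurable_absmoment (p : R) : measurable_fun setT (fun w => `|Y w| `^ p).
Proof.
exact: (measurableT_comp (measurable_powR p)
  (measurableT_comp (@normr_measurable R setT) (measurable_funPT Y))).
Qed.

Lemma integrable_absmoment : ('E_P[fun w => (`|Y w| `^ (2 + delta))%R] < +oo)%E ->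
  P.-integrable setT (EFin \o (fun w => `|Y w| `^ (2 + delta))).
Proof.
rewrite unlock => Yfin; apply/integrableP; split.
  by apply/measurable_EFinP; exact: measurable_absmoment.
by under eq_integral do rewrite /= ger0_norm ?powR_ge0//.
Qed.

Hypothesis Y_moment : P.-integrable setT (EFin \o (fun w => `|Y w| `^ (2 + delta))).

Lemma integrable_sqr_of_absmoment : P.-integrable setT (EFin \o (fun w => Y w ^+ 2)).
Proof.
have i1 : P.-integrable setT (EFin \o cst 1).
  exact: finite_measure_integrable_cst.
apply: le_integrable (integrableD _ i1 Y_moment) => //.
  by apply/measurable_EFinP; exact: measurable_funX.
move=> w _ /=; rewrite lee_fin ger0_norm ?sqr_ge0//.
apply: le_trans (ler_norm _).
have := @sqr_le_powR _ (Y w) 1 delta ltr01 delta_gt0.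
by rewrite powR1 invr1 mul1r expr1n.
Qed.

Lemma integrable_of_absmoment : P.-integrable setT (EFin \o Y).
Proof.
have i1 : P.-integrable setT (EFin \o cst 1).
  exact: finite_measure_integrable_cst.
apply: le_integrable (integrableD _ i1 integrable_sqr_of_absmoment) => //.
  exact/measurable_EFinP.
move=> w _ /=; rewrite lee_fin; apply: le_trans (ler_norm _).
rewrite -(real_normK (num_real (Y w))).
have : 0 <= `|Y w| by []. nra.
Qed.

Lemma integrable_cubic_error s : 
  P.-integrable setT (EFin \o (fun w => cubic_error (Y w / s))).
Proof.
apply: le_integrable (integrableZr _ (s^-1 ^+ 2) integrable_sqr_of_absmoment) => //.
  apply/measurable_EFinP; apply: measurableT_comp (@measurable_cubic_error R) _.
  exact: measurable_funM.
move=> w _ /=; rewrite lee_fin ger0_norm ?cubic_error_ge0//.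
apply: le_trans (ler_norm _); rewrite -exprMn; exact: cubic_error_le2.
Qed.

Variables (eps s : R).
Hypotheses (eps_gt0 : 0 < eps) (s_gt0 : 0 < s).

Lemma Rintegral_cubic_error_le :
  \int[P]_w cubic_error (Y w / s) <=
  eps * ((s ^+ 2)^-1 * \int[P]_w Y w ^+ 2) +
  (eps `^ delta)^-1 * ((s `^ (2 + delta))^-1 * \int[P]_w `|Y w| `^ (2 + delta)).
Proof.
have iY2 := integrable_sqr_of_absmoment.
rewrite !mulrA -(RintegralZl _ _ iY2)// -(RintegralZl _ _ Y_moment)//.
have j1 : P.-integrable setT (EFin \o (fun w => eps * (s ^+ 2)^-1 * Y w ^+ 2)).
  exact: (integrableZl measurableT (eps * (s ^+ 2)^-1) iY2).
have j2 : P.-integrable setT (EFin \o (fun w =>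
    (eps `^ delta)^-1 * (s `^ (2 + delta))^-1 * `|Y w| `^ (2 + delta))).
  exact: (integrableZl measurableT _ Y_moment).
rewrite -RintegralD//; apply: le_Rintegral => //.
- exact: integrable_cubic_error.
- exact: (integrableD _ j1 j2).
move=> w _; have := @cubic_error_le_powR R (Y w / s) eps delta eps_gt0 delta_gt0.
by rewrite (powR_normM_inv _ _ s_gt0) expr_div_n [_ / s ^+ 2]mulrC !mulrA.
Qed.

Lemma Rintegral_sqr_le :
  (s ^+ 2)^-1 * \int[P]_w Y w ^+ 2 <= eps ^+ 2 +
  (eps `^ delta)^-1 * ((s `^ (2 + delta))^-1 * \int[P]_w `|Y w| `^ (2 + delta)).
Proof.
have iY2 := integrable_sqr_of_absmoment.
rewrite !mulrA -(RintegralZl _ _ iY2)// -(RintegralZl _ _ Y_moment)//.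
have j1 : P.-integrable setT (EFin \o (fun w => (s ^+ 2)^-1 * Y w ^+ 2)).
  exact: (integrableZl measurableT (s ^+ 2)^-1 iY2).
have j2 : P.-integrable setT (EFin \o (fun w =>
    (eps `^ delta)^-1 * (s `^ (2 + delta))^-1 * `|Y w| `^ (2 + delta))).
  exact: (integrableZl measurableT _ Y_moment).
have j0 : P.-integrable setT (EFin \o cst (eps ^+ 2)).
  exact: finite_measure_integrable_cst.
rewrite -[X in _ <= X + _](Rintegral_cst_prob P) -RintegralD//.
apply: le_Rintegral => //; first exact: (integrableD _ j0 j2).
move=> w _; have := @sqr_le_powR R (Y w / s) eps delta eps_gt0 delta_gt0.
by rewrite (powR_normM_inv _ _ s_gt0) expr_div_n [_ / s ^+ 2]mulrC !mulrA.
Qed.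

End moments.

Definition normal_absmoment3 : R := \int[gamma]_z `|z| ^+ 3.

Lemma normal_absmoment3_ge0 : 0 <= normal_absmoment3.
Proof. by apply: Rintegral_ge0 => z _; exact: exprn_ge0. Qed.

Lemma integrable_normal_absmoment3 :
  gamma.-integrable setT (EFin \o (fun z : R => `|z| ^+ 3)).
Proof.
apply/integrableP; split.
  apply/measurable_EFinP; apply: measurable_funX; exact: normr_measurable.
under eq_integral do rewrite /= ger0_norm ?exprn_ge0//.
by rewrite normal_prob_moment3 ltry.
Qed.

Lemma integrable_normal_cubic_error (t : R) :
  gamma.-integrable setT (EFin \o (fun z => cubic_error (t * z))).
Proof.
apply: le_integrable (integrableZl _ (`|t| ^+ 3) integrable_normal_absmoment3) => //.
  apply/measurable_EFinP; apply: measurableT_comp (@measurable_cubic_error R) _.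
  exact: measurable_funM.
move=> z _ /=; rewrite lee_fin ger0_norm ?cubic_error_ge0//.
by apply: le_trans (ler_norm _); rewrite -exprMn -normrM; exact: cubic_error_le3.
Qed.

Lemma Rintegral_normal_cubic_error_le (t : R) :
  \int[gamma]_z cubic_error (t * z) <= `|t| ^+ 3 * normal_absmoment3.
Proof.
have i3 := integrable_normal_absmoment3.
rewrite -(RintegralZl _ _ i3)//; apply: le_Rintegral => //.
- exact: integrable_normal_cubic_error.
- exact: (integrableZl measurableT _ i3).
- by move=> z _; rewrite -exprMn -normrM; exact: cubic_error_le3.
Qed.

End block_error.

(** * The replacement error of one block *)

Section block_approximation.
Context d (T : measurableType d) (R : realType) (P : probability T R).
Local Notation gamma := (@normal_prob R 0 1).
Variables (X : nat -> {RV P >-> R}) (m j : nat) (delta eps : R).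
Hypotheses (m_gt0 : (0 < m)%N) (mj : (m <= j)%N).
Hypothesis X_indep : mutually_independent P [set k | (1 <= k)%N] X.
Hypothesis delta_gt0 : 0 < delta.
Hypothesis X_mean : forall k, (m <= k)%N -> \int[P]_w X k w = 0.
Hypothesis X_moment : forall k, (m <= k)%N ->
  P.-integrable setT (EFin \o (fun w => `|X k w| `^ (2 + delta))).

Local Notation variance k := (\int[P]_w X k w ^+ 2).
Local Notation sd k := (Num.sqrt (variance k)).
Local Notation absmoment k := (\int[P]_w `|X k w| `^ (2 + delta)).
Local Notation s := (Num.sqrt (\sum_(m <= k < j) variance k)).
Local Notation M3 := (normal_absmoment3 R).

Hypothesis s_gt0 : 0 < s.
Hypotheses (eps_gt0 : 0 < eps) (eps_le1 : eps <= 1).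
Hypothesis ratio_le :
  (s `^ (2 + delta))^-1 * \sum_(m <= k < j) absmoment k <= eps `^ (2 + delta).

Let sum_variance : \sum_(m <= k < j) (s ^+ 2)^-1 * variance k = 1.
Proof.
rewrite -mulr_sumr sqr_sqrtr ?mulVf//; last first.
  by apply: sumr_ge0 => k _; exact: variance_ge0.
by move: s_gt0; rewrite sqrtr_gt0 => /gt_eqF ->.
Qed.

Let scaled_moments_le :
  \sum_(m <= k < j)
    (eps `^ delta)^-1 * ((s `^ (2 + delta))^-1 * absmoment k) <= eps ^+ 2.
Proof.
rewrite -!mulr_sumr -ler_pdivlMl ?invr_gt0 ?powR_gt0// invrK.
apply: le_trans ratio_le _; rewrite powRD; last by rewrite (gt_eqF eps_gt0) implybT.
by rewrite (powR_mulrn _ (ltW eps_gt0)) mulrC.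
Qed.

Let scaled_moment_le k : (m <= k < j)%N ->
  (eps `^ delta)^-1 * ((s `^ (2 + delta))^-1 * absmoment k) <= eps ^+ 2.
Proof.
move=> mkj; apply: le_trans scaled_moments_le.
rewrite [leRHS](bigD1_seq k) ?mem_index_iota ?iota_uniq//= lerDl.
apply: sumr_ge0 => i _; rewrite !mulr_ge0 ?invr_ge0 ?powR_ge0//.
by apply: Rintegral_ge0 => w _; exact: powR_ge0.
Qed.

(** No term dominates the block: this is the classical uniform negligibility
condition, with an explicit rate. *)
Lemma sd_ratio_le k : (m <= k < j)%N -> sd k / s <= 2 * eps.
Proof.
move=> mkj; have /andP[mk _] := mkj.
rewrite -(@ler_pXn2r _ 2)// ?nnegrE ?divr_ge0 ?sqrtr_ge0//; last first.
  by rewrite mulr_ge0// ltW.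
rewrite expr_div_n sqr_sqrtr ?variance_ge0// mulrC.
apply: le_trans (Rintegral_sqr_le delta_gt0 (X_moment mk) eps_gt0 s_gt0) _.
have := scaled_moment_le mkj; have := sqr_ge0 eps; rewrite exprMn; lra.
Qed.

(** The normalized variances sum to 1, so that the quadratic terms contribute
[eps] and the terms of order [2 + delta] contribute [eps ^+ 2 <= eps].  On the
Gaussian side [t ^+ 3 <= 2 * eps * t ^+ 2] for each ratio [t = sd k / s]. *)
Lemma block_error_le :
  \sum_(m <= k < j) (\int[P]_w cubic_error (X k w / s) +
    \int[gamma]_z cubic_error (sd k / s * z)) <= (2 + 2 * M3) * eps.
Proof.
have M30 := normal_absmoment3_ge0 R.
rewrite big_split/= mulrDl lerD//.
  apply: (@le_trans _ _ (\sum_(m <= k < j) (eps * ((s ^+ 2)^-1 * variance k) +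
    (eps `^ delta)^-1 * ((s `^ (2 + delta))^-1 * absmoment k)))).
    apply: ler_sum_nat => k /andP[mk _].
    exact: (Rintegral_cubic_error_le delta_gt0 (X_moment mk) eps_gt0 s_gt0).
  rewrite big_split/= -mulr_sumr sum_variance mulr1.
  have e2 : eps ^+ 2 <= eps by rewrite expr2 ler_piMr// ltW.
  apply: le_trans (lerD (lexx eps) (le_trans scaled_moments_le e2)) _; lra.
apply: (@le_trans _ _ (\sum_(m <= k < j)
    2 * eps * M3 * ((s ^+ 2)^-1 * variance k))).
  apply: ler_sum_nat => k mkj.
  apply: le_trans (Rintegral_normal_cubic_error_le _) _.
  have r0 : 0 <= sd k / s by rewrite divr_ge0 ?sqrtr_ge0.
  rewrite ger0_norm// exprS.
  have -> : (sd k / s) ^+ 2 = (s ^+ 2)^-1 * variance k.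
    by rewrite expr_div_n (sqr_sqrtr (variance_ge0 X k)) mulrC.
  rewrite mulrAC ler_wpM2r ?mulr_ge0 ?invr_ge0 ?sqr_ge0 ?variance_ge0//.
  by rewrite ler_wpM2r// sd_ratio_le.
rewrite -mulr_sumr sum_variance; lra.
Qed.

(** The replacement lemma applied to [step] composed with an affine map of slope
[l / s].  The bounds on the test functions depend on the block through [s], but
the error [E] is a fixed multiple of [cubic_error (y / s)]. *)
Lemma step_approximation (l c : R) :
  `|\int[P]_w step (l * (partial_sum X m j w / s) + c) -
    \int[gamma]_z step (l * z + c)| <=
  3 * (l ^+ 2 + `|l| ^+ 3) * ((2 + 2 * M3) * eps).
Proof.
set C := 3 * (_ + _).
have C0 : 0 <= C by rewrite mulr_ge0// addr_ge0 ?sqr_ge0 ?exprn_ge0.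
pose E y := C * cubic_error (y / s).
pose g x := step (l / s * x + c).
pose a x := l / s * step_deriv (l / s * x + c).
pose b x := (l / s) ^+ 2 * step_half_deriv2 (l / s * x + c).
have gE : taylor2 E g a b.
  move=> x y; apply: le_trans (taylor2_affine (l / s) c step_taylor2 x y) _.
  rewrite /E /C -[leRHS]mulrA ler_wpM2l//; apply: le_trans (cubic_error_scale _ _).
  by rewrite mulrAC -mulrA.
have blg := bounded_lipschitz_affine 1 (l / s) c step_bounded_lipschitz.
have bla := bounded_lipschitz_affine (l / s) (l / s) c step_deriv_bounded_lipschitz.
have blb := bounded_lipschitz_affine ((l / s) ^+ 2) (l / s) c step_half_deriv2_bounded_lipschitz.
set Mg := (X in bounded_lipschitz X _) in blg.
set Ma := (X in bounded_lipschitz X _) in bla.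
set Mb := (X in bounded_lipschitz X _) in blb.
pose M := Num.max Mg (Num.max Ma Mb).
have {}blg : bounded_lipschitz M g.
  apply: (@bounded_lipschitz_le _ Mg); first by rewrite le_max lexx.
  by move: blg; congr bounded_lipschitz; apply/funext => x; rewrite mul1r.
have {}bla : bounded_lipschitz M a.
  by apply: bounded_lipschitz_le bla; rewrite !le_max lexx orbT.
have {}blb : bounded_lipschitz M b.
  by apply: bounded_lipschitz_le blb; rewrite !le_max lexx !orbT.
have E_int k : (m <= k)%N -> P.-integrable setT (EFin \o (E \o X k)).
  move=> mk; exact: (integrableZl measurableT C
    (integrable_cubic_error delta_gt0 (X_moment mk) s)).
have E_int_gauss t : 0 <= t ->
    gamma.-integrable setT (EFin \o (fun z => E (t * z))).
  move=> t0; rewrite (_ : (fun z => _) = fun z => C * cubic_error (t / s * z));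
    last by apply/funext => z; rewrite /E (mulrAC t).
  exact: (integrableZl measurableT C (integrable_normal_cubic_error (t / s))).
have main := lindeberg_replacement m_gt0 X_indep
  (fun k mk => integrable_of_absmoment delta_gt0 (X_moment mk))
  (fun k mk => integrable_sqr_of_absmoment delta_gt0 (X_moment mk))
  X_mean E_int E_int_gauss mj blg bla blb gE.
have gP w : g (partial_sum X m j w) = step (l * (partial_sum X m j w / s) + c).
  by rewrite /g mulrAC -mulrA.
have gG z : g (s * z) = step (l * z + c).
  by rewrite /g mulrA divfK// gt_eqF.
rewrite -(eq_Rintegral P (fun w _ => gP w)) -(eq_Rintegral gamma (fun z _ => gG z)).
apply: le_trans main _; apply: le_trans (ler_wpM2l C0 block_error_le).
rewrite mulr_sumr; apply: ler_sum_nat => k /andP[mk _].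
rewrite mulrDr lerD//.
- rewrite -RintegralZl//.
  exact: (integrable_cubic_error delta_gt0 (X_moment mk) s).
- rewrite -RintegralZl//; last exact: integrable_normal_cubic_error.
  rewrite le_eqVlt; apply/orP/or_introl/eqP/eq_Rintegral => z _.
  by rewrite /E (mulrAC (sd k)).
Qed.

End block_approximation.

(** * From smooth test functions to distribution functions *)

Section smoothed_indicator.
Context d (T : measurableType d) (R : realType) (Q : probability T R).
Variables (Y : T -> R) (t eta : R).
Hypotheses (mY : measurable_fun setT Y) (eta_gt0 : 0 < eta).

(** The spline reversed and rescaled so as to fall from 1 at [t] to 0 at
[t + eta]. *)
Definition smoothed_indicator (t eta x : R) : R :=
  step (- 3 / eta * x + 3 * (t + eta) / eta).
Local Notation h := (smoothed_indicator t eta).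

Let smoothed_indicatorE x : h x = step (3 * ((t + eta - x) / eta)).
Proof. by rewrite /smoothed_indicator; congr step; field; rewrite gt_eqF. Qed.

Lemma smoothed_indicator_bounds x : 0 <= h x <= 1.
Proof. exact: step_bounds. Qed.

Lemma smoothed_indicator1 x : x <= t -> h x = 1.
Proof.
move=> xt; rewrite smoothed_indicatorE step_ge3// ler_peMr//.
by rewrite ler_pdivlMr// mul1r; lra.
Qed.

Lemma smoothed_indicator0 x : t + eta <= x -> h x = 0.
Proof.
move=> xt; rewrite smoothed_indicatorE step_le0// pmulr_rle0// pmulr_lle0 ?invr_gt0//.
lra.
Qed.

Lemma Rintegral_indic_le u : \int[Q]_w \1_`]-oo, u] (Y w) = fine (Q (Y @^-1` `]-oo, u])).
Proof.
rewrite /Rintegral; congr fine.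
transitivity (\int[Q]_w (\1_(Y @^-1` `]-oo, u]) w)%:E)%E => //.
rewrite integral_indic ?setIT//.
by rewrite -[X in measurable X]setTI; exact: mY.
Qed.

Let measurable_indicY u : measurable_fun setT (fun w => \1_`]-oo, u] (Y w) : R).
Proof. by apply: measurableT_comp => //; exact: measurable_indic. Qed.

Let integrable_indicY u : Q.-integrable setT (EFin \o (fun w => \1_`]-oo, u] (Y w) : R)).
Proof.
apply: (@bounded_integrable _ _ _ Q _ 1) => // w.
by rewrite indicE; case: (_ \in _); rewrite ?normr1 ?normr0.
Qed.

Let integrable_hY : Q.-integrable setT (EFin \o (fun w => h (Y w))).
Proof.
apply: (@bounded_integrable _ _ _ Q _ 1).
  apply: (measurableT_comp (f := h)) => //.
  apply: continuous_measurable_fun.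
  apply: bounded_lipschitz_continuous.
  have := bounded_lipschitz_affine 1 (- 3 / eta) (3 * (t + eta) / eta) step_bounded_lipschitz.
  by under eq_fun do rewrite mul1r; exact.
by move=> w; have /andP[? ?] := smoothed_indicator_bounds (Y w); rewrite ger0_norm.
Qed.

Lemma le_smoothed_indicator :
  fine (Q (Y @^-1` `]-oo, t])) <= \int[Q]_w h (Y w).
Proof.
rewrite -Rintegral_indic_le; apply: le_Rintegral => // w _.
rewrite indicE; have [|_] := boolP (_ \in _); last first.
  by have /andP[] := smoothed_indicator_bounds (Y w).
by rewrite inE/= in_itv/= => /smoothed_indicator1 ->.
Qed.

Lemma ge_smoothed_indicator :
  \int[Q]_w h (Y w) <= fine (Q (Y @^-1` `]-oo, (t + eta)])).
Proof.
rewrite -Rintegral_indic_le; apply: le_Rintegral => // w _.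
rewrite indicE; have [_|] := boolP (_ \in _).
  by have /andP[] := smoothed_indicator_bounds (Y w).
rewrite notin_setE/= in_itv/= => /negP; rewrite -ltNge => /ltW.
by move=> /smoothed_indicator0 ->.
Qed.

End smoothed_indicator.

Section normal_cdf.
Context {R : realType}.
Local Notation mu := (@lebesgue_measure R).
Local Notation gamma := (@normal_prob R 0 1).

Definition normal_cdf (t : R) : R := fine (gamma `]-oo, t]).

(** The density is bounded by its peak. *)
Lemma normal_cdf_lipschitz (t eta : R) : 0 < eta ->
  normal_cdf (t + eta) <= normal_cdf t + normal_peak 1 * eta.
Proof.
move=> eta0; rewrite /normal_cdf.
have tte : t <= t + eta by rewrite lerDl ltW.
have -> : `]-oo, (t + eta)]%classic = `]-oo, t]%classic `|` `]t, (t + eta)]%classic.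
  by rewrite -itv_bndbnd_setU.
rewrite measureU//=; last first.
  apply/seteqP; split=> // x /=; rewrite !in_itv/= => -[xt /andP[tx _]].
  by move: (lt_le_trans tx xt); rewrite ltxx.
rewrite fineD ?fin_num_measure// lerD2l.
have : (gamma `]t, (t + eta)%R] <= (normal_peak 1 * eta)%:E)%E.
  apply: (@le_trans _ _ (\int[mu]_(x in `]t, (t + eta)%R]) (normal_peak 1)%:E)%E).
    apply: ge0_le_integral => //=.
    - by move=> x _; rewrite lee_fin normal_pdf_ge0.
    - by apply: measurable_funTS; exact: measurable_normal_pdfE.
    - by move=> x _; rewrite lee_fin normal_pdf_ub// oner_neq0.
  rewrite integral_cst//= lebesgue_measure_itv/= lte_fin ltrDl eta0.
  by rewrite -EFinD addrAC subrr add0r.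
by rewrite -lee_fin fineK ?fin_num_measure.
Qed.

End normal_cdf.

Section lyapunov_block.
Context d (T : measurableType d) (R : realType) (P : probability T R).
Local Notation gamma := (@normal_prob R 0 1).
Variables (X : nat -> {RV P >-> R}) (p : nat -> nat) (delta : R).

Lemma block_sdE n : block_sd X p n =
  Num.sqrt (\sum_((p n).+1 <= k < (n + p n).+1) \int[P]_w X k w ^+ 2).
Proof.
by rewrite /block_sd; congr Num.sqrt; apply: eq_bigr => k _; rewrite unlock.
Qed.

Lemma lyapunov_ratioE n : lyapunov_ratio X p delta n =
  (block_sd X p n `^ (2 + delta))^-1 *
  \sum_((p n).+1 <= k < (n + p n).+1) \int[P]_w `|X k w| `^ (2 + delta).
Proof.
by rewrite /lyapunov_ratio; congr (_ * _); apply: eq_bigr => k _; rewrite unlock.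
Qed.

Hypothesis X_indep : mutually_independent P [set k | (1 <= k)%N] X.
Hypothesis X_centered : forall k, (1 <= k)%N -> ('E_P[X k] = 0)%E.
Hypothesis delta_gt0 : 0 < delta.
Hypothesis X_moment : forall k, (1 <= k)%N ->
  ('E_P[fun w => (`|X k w| `^ (2 + delta))%R] < +oo)%E.

Lemma block_step_approximation n (eps l c : R) : 0 < block_sd X p n ->
  0 < eps -> eps <= 1 -> lyapunov_ratio X p delta n <= eps `^ (2 + delta) ->
  `|\int[P]_w step (l * normalized_block_sum X p n w + c) -
    \int[gamma]_z step (l * z + c)| <=
  3 * (l ^+ 2 + `|l| ^+ 3) * ((2 + 2 * normal_absmoment3 R) * eps).
Proof.
rewrite lyapunov_ratioE block_sdE => s0 e0 e1 ratio.
have mean k : ((p n).+1 <= k)%N -> \int[P]_w X k w = 0.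
  move=> /(leq_trans (ltn0Sn _)) k0; have := X_centered k0.
  by rewrite unlock /Rintegral => ->.
have moment k : ((p n).+1 <= k)%N ->
    P.-integrable setT (EFin \o (fun w => `|X k w| `^ (2 + delta))).
  by move=> /(leq_trans (ltn0Sn _)) k0; apply: integrable_absmoment; exact: X_moment.
have mj : ((p n).+1 <= (n + p n).+1)%N by rewrite ltnS leq_addl.
have := step_approximation (ltn0Sn _) mj X_indep delta_gt0 mean moment s0 e0 e1 ratio l c.
by rewrite -block_sdE.
Qed.

Lemma cdf_sandwich (F G I J I' J' G' G'' K err : R) :
  F <= I -> `|I - J| <= err -> J <= G' -> G' <= G + K ->
  I' <= F -> `|I' - J'| <= err -> G'' <= J' -> G <= G'' + K ->
  `|F - G| <= K + err.
Proof.
rewrite !ler_norml => ? /andP[? ?] ? ? ? /andP[? ?] ? ?.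
by apply/andP; split; lra.
Qed.

(** The indicator of [x <= t] lies between the smoothed indicators that decrease on
[[t - eta, t]] and on [[t, t + eta]]; moving [t] by [eta] costs at most
[normal_peak 1 * eta] on the Gaussian side. *)
Lemma normalized_block_sum_cdf n (t eta err : R) : 0 < eta ->
  (forall u, `|\int[P]_w smoothed_indicator u eta (normalized_block_sum X p n w) -
     \int[gamma]_z smoothed_indicator u eta z| <= err) ->
  `|fine (P (normalized_block_sum X p n @^-1` `]-oo, t])) - normal_cdf t| <=
  normal_peak 1 * eta + err.
Proof.
move=> eta0 approx; pose Y := normalized_block_sum X p n.
have mY : measurable_fun setT Y by exact: measurable_normalized_block_sum.
have mid : measurable_fun [set: measurableTypeR R] (idfun : measurableTypeR R -> R).
  exact: measurable_id.
apply: (cdf_sandwich _ (approx t) _ _ _ (approx (t - eta))).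
- exact: le_smoothed_indicator.
- exact: (ge_smoothed_indicator gamma t mid eta0).
- exact: normal_cdf_lipschitz.
- by have := ge_smoothed_indicator P (t - eta) mY eta0; rewrite subrK.
- exact: (le_smoothed_indicator gamma (t - eta) mid eta0).
- by have := normal_cdf_lipschitz (t - eta) eta0; rewrite subrK.
Qed.

End lyapunov_block.

Theorem theorem1 (d : measure_display) (T : measurableType d) (R : realType)
    (P : probability T R) (X : nat -> {RV P >-> R}) (p : nat -> nat) (delta : R)
    (X_indep : mutually_independent P [set k | (1 <= k)%N] X)
    (X_centered : forall k, (1 <= k)%N -> ('E_P[X k] = 0)%E)
    (delta_gt0 : 0 < delta)
    (X_moment : forall k, (1 <= k)%N ->
      ('E_P[fun w => (`|X k w| `^ (2 + delta))%R] < +oo)%E)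
    (sd_gt0 : forall n, (1 <= n)%N -> 0 < block_sd X p n)
    (lyapunov : lyapunov_ratio X p delta n @[n --> \oo] --> (0 : R)) :
  cvg_in_distribution P (fun n => normalized_block_sum X p n) (normal_prob 0 1).
Proof.
move=> t _; rewrite -[X in _ --> X]fineK ?fin_num_measure//.
apply: cvg_EFin; first by near=> n; rewrite fin_num_measure.
apply/cvgrPdist_le => e e0.
have peak0 : 0 < normal_peak (1 : R) by rewrite normal_peak_gt0// oner_neq0.
(* One half of [e] pays for the shift [eta], the other for [C * eps], where [C]
   depends on [eta] through the slope of the smoothed indicators. *)
pose eta := e / 2 / normal_peak 1.
have eta0 : 0 < eta by rewrite !divr_gt0.
pose C := 3 * ((- 3 / eta) ^+ 2 + `|- 3 / eta| ^+ 3) *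
  (2 + 2 * normal_absmoment3 R).
have C0 : 0 <= C.
  by rewrite !mulr_ge0 ?addr_ge0 ?sqr_ge0 ?exprn_ge0// mulr_ge0 ?normal_absmoment3_ge0.
pose eps := Num.min 1 (e / 2 / (C + 1)).
have C1 : 0 < C + 1 by rewrite ltr_wpDl.
have eps0 : 0 < eps by rewrite lt_min ltr01 !divr_gt0.
have Ceps : C * eps <= e / 2.
  apply: (@le_trans _ _ ((C + 1) * eps)); first by rewrite ler_wpM2r ?lerDl// ltW.
  by rewrite mulrC -ler_pdivlMr// ge_min lexx orbT.
near=> n.
have n1 : (1 <= n)%N by near: n; exact: nbhs_infty_ge.
have ratio : lyapunov_ratio X p delta n <= eps `^ (2 + delta).
  near: n; apply: (cvgr_le _ lyapunov); exact: powR_gt0.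
rewrite distrC.
apply: (le_trans (@normalized_block_sum_cdf _ _ _ _ X p n t eta (C * eps) eta0 _)).
  move=> u; rewrite /C -mulrA.
  apply: (block_step_approximation X_indep X_centered delta_gt0 X_moment) => //.
    exact: sd_gt0.
  by rewrite ge_min lexx.
by rewrite /eta mulrC divfK ?gt_eqF// {2}(splitr e) lerD2l.
Unshelve. all: by end_near. Qed.
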